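(* For every tree $T$, if $\mathrm{lmw}(T)=k$ then $k\le \mathrm{lmw}(T^2)\le 2k$. Moreover, both bounds are tight for every $k\ge 0$: for every integer $k\ge 0$ there exists a tree $T$ with $\mathrm{lmw}(T)=\mathrm{lmw}(T^2)=k$, and there exists a tree $T'$ with $\mathrm{lmw}(T')=k$ and $\mathrm{lmw}(T'^2)=2k$.
   Context: All graphs are finite and simple. For a graph $G$, its square $G^2$ is the graph on $V(G)$ in which two distinct vertices are adjacent iff their distance in $G$ is at most $2$. For disjoint $S,T\subseteq V(G)$, $G[S,T]$ denotes the bipartite graph on $S\cup T$ whose edges are exactly the edges of $G$ with one endpoint in $S$ and the other in $T$. $\mathrm{mim}(H)$ is the maximum number of edges in an induced matching of $H$. A linear layout of an $n$-vertex graph $G$ is a bijection $\sigma:V(G)\to\{1,\dots,n\}$; write $v_i=\sigma^{-1}(i)$ and $V_i^\sigma=\{v_1,\dots,v_i\}$, $\overline{V_i^\sigma}=V(G)\setminus V_i^\sigma$. The MIM-width of $G$ under $\sigma$ is $\mathrm{mw}(\sigma,G)=\max_{1\le i<n}\mathrm{mim}(G[V_i^\sigma,\overline{V_i^\sigma}])$ (equal to $0$ if $n\le 1$). The linear MIM-width $\mathrm{lmw}(G)$ is the minimum of $\mathrm{mw}(\sigma,G)$ over all linear layouts $\sigma$ of $G$. *)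

(* Defs.v *)
From mathcomp Require Import all_boot.
Set Implicit Arguments. Unset Strict Implicit. Unset Printing Implicit Defensive.

Section Graphs.
Variable V : finType.
Implicit Types (e : rel V) (S T : {set V}).

Definition simple_graph e := symmetric e /\ irreflexive e.

Definition acyclic e :=
  forall c : seq V, uniq c -> 3 <= size c -> ~~ cycle e c.

Definition connected e := forall x y : V, connect e x y.

Definition is_tree e :=
  [/\ simple_graph e, 0 < #|V|, connected e & acyclic e].

Definition sq e : rel V :=
  fun x y => (x != y) && (e x y || [exists z, e x z && e z y]).

(* M is an induced matching of the bipartite graph G[S,T]; each edge of
   G[S,T] is represented as an oriented pair (s,t) with s in S, t in T. *)
Definition induced_matching e S T (M : {set V * V}) :=
  [forall p in M, (p.1 \in S) && (p.2 \in T) && e p.1 p.2] &&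
  [forall p in M, forall q in M, (p != q) ==>
     [&& p.1 != q.1, p.2 != q.2 & ~~ e p.1 q.2]].

Definition mim e S T : nat :=
  \max_(M : {set V * V} | induced_matching e S T M) #|M|.

(* A linear layout: a bijection sigma : V -> {0,...,n-1} (0-indexed
   version of {1,...,n}). V_i = { v | sigma v < i }. *)
Definition layout := {ffun V -> 'I_#|V|}.
Definition is_layout (sigma : layout) := injectiveb sigma.

Definition prefix_set (sigma : layout) (i : nat) : {set V} :=
  [set v | sigma v < i].

(* mw(sigma, G) = max over 1 <= i < n of mim(G[V_i, V \ V_i]); 0 if n <= 1. *)
Definition mw e (sigma : layout) : nat :=
  \max_(i < #|V| | 1 <= i) mim e (prefix_set sigma i) (~: prefix_set sigma i).

(* lmw(G) = min over layouts of mw. The neutral element #|V| is harmless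
   since layouts always exist and mw <= #|V|. *)
Definition lmw e : nat :=
  \big[minn/#|V|]_(sigma : layout | is_layout sigma) mw e sigma.

End Graphs.

(* Main.v *)
Require Import Defs.
From mathcomp Require Import all_boot.
Set Implicit Arguments. Unset Strict Implicit. Unset Printing Implicit Defensive.

(* Every edge of an induced matching of a cut of G^2 is either an edge of G or
   passes through a midpoint; keeping the edges whose midpoint lies on the more
   frequent side and moving one endpoint to the midpoint gives an induced
   matching of the same cut of G, whence lmw(G^2) <= 2 lmw(G) for every graph.

   Conversely, for a tree T, call a neighbour v of x bad if some branch hanging
   from v away from x has a square of width more than k. Three bad neighbours of
   x force width k + 2 in T^2: at the median of the three cuts forced by the
   branches, the two outer ones, joined through x in T^2, contribute an extra
   edge. If no vertex has three bad neighbours, the bad directions follow a path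
   P such that all the components of T - N[P] have squares of width at most k;
   laying out T along P costs one extra edge, so induction on k applies.

   For lmw(T) = lmw(T^2) = k, attach three copies of the previous tree to a centre
   by paths of length two. For lmw(T^2) = 2k, hang three copies at each of three
   neighbours of a centre, with a pendant root above the centre: in the square,
   the median argument applies once among the copies at a common neighbour and
   once more among the three neighbours, whereas in T a single path P meets the
   neighbourhoods of all the copies. *)

(** * Widths of vertex sets *)

Section Mim.
Variable V : finType.
Implicit Types (e g : rel V) (A B S T : {set V}) (M : {set V * V}).

Lemma induced_matchingP g A B M :
  reflect ((forall p, p \in M -> [/\ p.1 \in A, p.2 \in B & g p.1 p.2]) /\
           (forall p q, p \in M -> q \in M -> p != q ->
              [/\ p.1 != q.1, p.2 != q.2 & ~~ g p.1 q.2]))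
          (induced_matching g A B M).
Proof.
apply: (iffP andP) => [[/forall_inP h1 /forall_inP h2]|[h1 h2]]; split.
- by move=> p /h1 /andP[/andP[]].
- by move=> p q pM qM; move/forall_inP: (h2 p pM) => /(_ q qM) /implyP h /h /and3P[].
- by apply/forall_inP => p /h1[-> -> ->].
- apply/forall_inP => p pM; apply/forall_inP => q qM; apply/implyP => /(h2 _ _ pM qM).
  by case=> -> -> ->.
Qed.

Lemma mim_leP g A B k :
  reflect (forall M, induced_matching g A B M -> #|M| <= k) (mim g A B <= k).
Proof. exact: bigmax_leqP. Qed.

Lemma card_le_mim g A B M : induced_matching g A B M -> #|M| <= mim g A B.
Proof. by move=> h; apply: leq_bigmax_cond. Qed.

Lemma mim_witness g A B k : k <= mim g A B ->
  exists2 M, induced_matching g A B M & k <= #|M|.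
Proof.
move=> hk; have h0 : induced_matching g A B set0.
  by apply/induced_matchingP; split=> [p|p q]; rewrite inE.
have [|M hM eqM] := @eq_bigmax_cond _ (induced_matching g A B) (fun M => #|M|).
  by apply/card_gt0P; exists set0.
by exists M; rewrite // -eqM.
Qed.

Lemma mim_mono g A B A' B' :
  (forall a b, a \in A -> b \in B -> g a b -> (a \in A') && (b \in B')) ->
  mim g A B <= mim g A' B'.
Proof.
move=> h; apply/mim_leP => M /induced_matchingP[h1 h2].
apply: card_le_mim; apply/induced_matchingP; split=> // p /h1[pA pB pg].
by case/andP: (h _ _ pA pB pg).
Qed.

Lemma mim_no_edge g A B :
  (forall a b, a \in A -> b \in B -> ~~ g a b) -> mim g A B <= 0.
Proof.
move=> h; apply/mim_leP=> M /induced_matchingP[h1 _].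
rewrite leqn0 cards_eq0; apply/eqP/setP=> p; rewrite inE; apply/negP=> /h1[pA pB].
exact/negP/h.
Qed.

(** Two matching edges outside [A'] and [B'] would be the excluded configuration, so at most one
    exists; the others form an induced matching between [A'] and [B']. *)
Lemma mim_extra g A B A' B' k :
  mim g A' B' <= k ->
  (forall a b a' b', a \in A -> a' \in A -> b \in B -> b' \in B ->
    g a b -> g a' b' -> ~~ ((a \in A') && (b \in B')) ->
    ~~ ((a' \in A') && (b' \in B')) ->
    a != a' -> b != b' -> ~~ g a b' -> ~~ g a' b -> False) ->
  mim g A B <= k.+1.
Proof.
move=> hk h; apply/mim_leP => M /induced_matchingP[h1 h2].
pose N := [set p : V * V | (p.1 \in A') && (p.2 \in B')].
rewrite -(cardsID N M) -addn1 leq_add //.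
  apply: leq_trans hk; apply: card_le_mim; apply/induced_matchingP; split.
    by move=> p; rewrite !inE => /andP[/h1[_ _ ->] /andP[-> ->]].
  by move=> p q; rewrite !inE => /andP[pM _] /andP[qM _]; apply: h2.
apply/card_le1_eqP => p q; rewrite !inE => /andP[pN pM] /andP[qN qM].
apply: contraTeq isT => pq; rewrite eq_sym in pq.
have [pA pB pg] := h1 _ pM; have [qA qB qg] := h1 _ qM.
have [n1 n2 n3] := h2 _ _ pM qM pq.
have [_ _ n4] := h2 _ _ qM pM (contra_neq esym pq).
by case: (h p.1 p.2 q.1 q.2).
Qed.

Lemma mim_le1 g A B :
  (forall a b a' b', a \in A -> a' \in A -> b \in B -> b' \in B ->
    g a b -> g a' b' -> a != a' -> b != b' -> ~~ g a b' -> ~~ g a' b -> False) ->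
  mim g A B <= 1.
Proof.
move=> h; apply: (@mim_extra _ _ _ set0 set0).
  by apply: mim_no_edge => a b; rewrite inE.
by move=> a b a' b' ? ? ? ? ? ? _ _; apply: h.
Qed.

Lemma mim_le_card g A B : mim g A B <= #|V|.
Proof.
apply/mim_leP => M /induced_matchingP[_ h].
rewrite -(@card_in_imset _ _ fst) ?max_card // => p q pM qM eq1.
by apply/eqP; apply: contraT => /(h _ _ pM qM)[]; rewrite eq1 eqxx.
Qed.

Lemma mim_swap g A B : symmetric g -> mim g A B <= mim g B A.
Proof.
move=> gs; apply/mim_leP => M /induced_matchingP[h1 h2].
pose sw (p : V * V) := (p.2, p.1).
have swi : injective sw by move=> [a b] [c d] [-> ->].
rewrite -(card_imset _ swi); apply: card_le_mim; apply/induced_matchingP; split.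
  by move=> _ /imsetP[p /h1[pA pB pg] ->]; split=> //=; rewrite gs.
move=> _ _ /imsetP[p pM ->] /imsetP[q qM ->]; rewrite (inj_eq swi) => pq.
have [n1 n2 _] := h2 _ _ pM qM pq.
have [_ _ n3] := h2 _ _ qM pM (contra_neq esym pq).
by split=> //=; rewrite gs.
Qed.

End Mim.

Section MimEmbedding.
Variables (V V' : finType) (g : rel V) (g' : rel V') (h : V -> V').
Hypotheses (h_inj : injective h) (h_mono : {mono h : x y / g x y >-> g' x y}).

Lemma mim_imset (A B : {set V}) : mim g' (h @: A) (h @: B) = mim g A B.
Proof.
pose h2 (p : V * V) := (h p.1, h p.2).
have h2i : injective h2 by move=> [a b] [c d] [/h_inj-> /h_inj->].
apply/eqP; rewrite eqn_leq; apply/andP; split; apply/mim_leP => M /induced_matchingP[m1 m2].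
  have -> : M = h2 @: (h2 @^-1: M).
    apply/setP=> p; apply/idP/imsetP => [pM|[q]]; last by rewrite inE => ? ->.
    have [/imsetP[a _ ea] /imsetP[b _ eb] _] := m1 _ pM.
    by exists (a, b); rewrite ?inE /h2 /= -ea -eb -surjective_pairing.
  rewrite card_imset //; apply: card_le_mim; apply/induced_matchingP; split.
    by move=> p; rewrite inE => /m1[]; rewrite /h2 /= !mem_imset // h_mono.
  move=> p q; rewrite !inE => pM qM pq; have := m2 _ _ pM qM.
  by rewrite (inj_eq h2i) => /(_ pq) /=; rewrite !(inj_eq h_inj) h_mono.
rewrite -(card_imset _ h2i); apply: card_le_mim; apply/induced_matchingP; split.
  by move=> _ /imsetP[p /m1[pA pB pg] ->]; rewrite /= !mem_imset ?h_mono.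
move=> _ _ /imsetP[p pM ->] /imsetP[q qM ->]; rewrite (inj_eq h2i) => pq.
by rewrite /= !(inj_eq h_inj) h_mono; apply: m2.
Qed.

End MimEmbedding.

Section Width.
Variable V : finType.
Implicit Types (e g : rel V) (A B S T : {set V}) (M : {set V * V}) (L R s t : seq V).

(* All cuts of [L ++ s ++ R] that fall inside [s] have mim at most [k]. *)
Definition cut_le g k L s R :=
  forall n, mim g [set x in L ++ take n s] [set x in drop n s ++ R] <= k.

(** Tuples and ordinals make this a boolean predicate; [width_leP] restates it with sequences and
    unbounded cut positions. *)
Definition width_le g S k :=
  [exists s : #|S|.-tuple V, [&& uniq s, [set x in s] == S &
     [forall i : 'I_#|S|.+1, mim g [set x in take i s] [set x in drop i s] <= k]]].

Lemma width_leP g S k :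
  reflect (exists s, [/\ uniq s, s =i S & cut_le g k [::] s [::]]) (width_le g S k).
Proof.
apply: (iffP existsP) => [[s /and3P[us /eqP eS /forallP h]]|[s [us eS h]]].
  exists s; split=> [//|x|n]; first by have /setP/(_ x) := eS; rewrite inE.
  rewrite cats0; case: (ltnP n #|S|.+1) => hn; first exact: (h (Ordinal hn)).
  have := h ord_max; have hn' := ltnW hn.
  by rewrite /= !(take_oversize, drop_oversize) ?size_tuple.
have sz : size s == #|S|.
  by rewrite -(card_uniqP us) (eq_card eS).
exists (Tuple sz); apply/and3P; split=> //=; first by apply/eqP/setP=> x; rewrite inE eS.
by apply/forallP => i; have := h i; rewrite cats0.
Qed.

Lemma width_le_seq g S k s :
  uniq s -> s =i S -> cut_le g k [::] s [::] -> width_le g S k.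
Proof. by move=> h1 h2 h3; apply/width_leP; exists s. Qed.

Lemma cut_le_cat g k L s t R :
  cut_le g k L s (t ++ R) -> cut_le g k (L ++ s) t R -> cut_le g k L (s ++ t) R.
Proof.
move=> h1 h2 n; rewrite take_cat drop_cat; case: ltnP => _.
  by rewrite -catA; apply: h1.
by rewrite catA; apply: h2.
Qed.

Lemma cut_le_weak g k k' L s R : k <= k' -> cut_le g k L s R -> cut_le g k' L s R.
Proof. by move=> kk h n; apply: leq_trans (h n) kk. Qed.

(** Edges inside the block contribute at most [k] to a cut, the others at most one. The inequalities
    [a != b'] and [a' != b] come for free: the two sides of a cut of a duplicate-free sequence are
    disjoint. *)
Lemma cut_le_block g k L s R :
  cut_le g k [::] s [::] -> uniq (L ++ s ++ R) ->
  (forall a b a' b', a \in L ++ s -> a' \in L ++ s -> b \in s ++ R -> b' \in s ++ R ->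
    g a b -> g a' b' -> ~~ ((a \in s) && (b \in s)) -> ~~ ((a' \in s) && (b' \in s)) ->
    a != a' -> b != b' -> a != b' -> a' != b -> ~~ g a b' -> ~~ g a' b -> False) ->
  cut_le g k.+1 L s R.
Proof.
move=> hk us h n.
apply: (@mim_extra _ _ _ _ [set x in take n s] [set x in drop n s]).
  by have := hk n; rewrite cats0.
have mt x : x \in take n s -> x \in s by apply: mem_take.
have md x : x \in drop n s -> x \in s by apply: mem_drop.
have : uniq (L ++ (take n s ++ drop n s) ++ R) by rewrite cat_take_drop.
rewrite -catA catA => us'.
have dis x y : x \in L ++ take n s -> y \in drop n s ++ R -> x != y.
  move=> hx hy; apply: contraTneq us' => exy; rewrite cat_uniq negb_and orbC negb_and.
  by rewrite negbK; apply/orP; left; apply/orP; left; apply/hasP; exists y; rewrite // -exy.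
have inL x : x \in L ++ take n s -> x \in L ++ s.
  by rewrite !mem_cat => /orP[->//|/mt ->]; rewrite orbT.
have inR x : x \in drop n s ++ R -> x \in s ++ R.
  by rewrite !mem_cat => /orP[/md ->//|->]; rewrite orbT.
have blk x y : x \in L ++ take n s -> y \in drop n s ++ R ->
    ~~ ((x \in take n s) && (y \in drop n s)) -> ~~ ((x \in s) && (y \in s)).
  move=> hx hy; apply: contra => /andP[xs ys]; apply/andP; split.
    move: hx; rewrite mem_cat => /orP[xL|//]; move: us.
    by rewrite cat_uniq => /and3P[_ /hasPn/(_ x)]; rewrite mem_cat xs xL => /(_ isT).
  move: hy; rewrite mem_cat => /orP[//|yR]; move: us.
  by rewrite catA cat_uniq => /and3P[_ /hasPn/(_ y yR)]; rewrite /= mem_cat ys orbT.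
move=> a b a' b'; rewrite !inE => aA aA' bB bB' gab gab' na na' n1 n2 n3 n4.
by apply: (h a b a' b') => //; auto.
Qed.

Lemma width_le_set0 g k : width_le g set0 k.
Proof.
apply: (@width_le_seq _ _ _ [::]) => // [x|n]; first by rewrite inE.
by apply: leq_trans (mim_no_edge _) _ => // a b; rewrite inE.
Qed.

Lemma cut_le_cat_nonadjacent g k s t :
  (forall a b, a \in s -> b \in t -> ~~ g a b) ->
  cut_le g k [::] s [::] -> cut_le g k [::] t [::] -> cut_le g k [::] (s ++ t) [::].
Proof.
move=> nst hs ht; apply: cut_le_cat => n.
  apply: leq_trans (hs n); apply: mim_mono => a b; rewrite !inE !cats0 /= => ha.
  rewrite ha mem_cat => /orP[-> //|hb] gab.
  by have := nst _ _ (mem_take ha) hb; rewrite gab.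
apply: leq_trans (ht n); apply: mim_mono => a b; rewrite !inE cats0 /= mem_cat.
move=> /orP[ha|-> ->//] hb gab.
by have := nst _ _ ha (mem_drop hb); rewrite gab.
Qed.

Lemma width_leU g A B k :
  (forall a b, a \in A -> b \in B -> (a != b) && ~~ g a b) ->
  width_le g A k -> width_le g B k -> width_le g (A :|: B) k.
Proof.
move=> nab /width_leP[s [us es hs]] /width_leP[t [ut et ht]].
apply: (@width_le_seq _ _ _ (s ++ t)).
- rewrite cat_uniq us ut andbT /=; apply/hasPn => b; rewrite et => bB.
  by apply/negP; rewrite /= es => aA; have := nab _ _ aA bB; rewrite eqxx.
- by move=> x; rewrite mem_cat es et inE.
- apply: cut_le_cat_nonadjacent => // a b; rewrite es et => ha hb.
  by case/andP: (nab _ _ ha hb).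
Qed.

Lemma width_le_bigcup (I : finType) g (F : I -> {set V}) k (us : seq I) :
  uniq us ->
  (forall u, u \in us -> width_le g (F u) k) ->
  (forall u u' a b, u \in us -> u' \in us -> u != u' -> a \in F u -> b \in F u' ->
     (a != b) && ~~ g a b) ->
  width_le g (\bigcup_(u <- us) F u) k.
Proof.
elim: us => [|u us IH] /=; first by move=> *; rewrite big_nil width_le_set0.
move=> /andP[nu uu] hF hd; rewrite big_cons; apply: width_leU.
- move=> a b aF; rewrite bigcup_seq => /bigcupP[u' u'us bF].
  apply: (hd u u'); rewrite ?inE ?eqxx ?u'us ?orbT //.
  by apply: contraNneq nu => ->.
- by apply: hF; rewrite mem_head.
- apply: IH => // [v hv|v v' a b hv hv']; first by apply: hF; rewrite inE hv orbT.
  by apply: hd; rewrite inE ?hv ?hv' orbT.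
Qed.

Lemma filter_cut (p : pred V) s n : exists m,
  take n (filter p s) = filter p (take m s) /\ drop n (filter p s) = filter p (drop m s).
Proof.
elim: s n => [|y s IH] n /=; first by exists 0.
case: ifP => py; last first.
  by have [m [h1 h2]] := IH n; exists m.+1; rewrite /= py.
case: n => [|n]; first by exists 0; rewrite /= py.
by have [m [h1 h2]] := IH n; exists m.+1; rewrite /= py h1.
Qed.

(** Filtering [s] by [A] gives an order of [A] whose cuts are traces of cuts of [s], so one of the
    latter is already wide within [A]. *)
Lemma width_gt_cut g A k s : uniq s -> {subset A <= s} -> ~~ width_le g A k ->
  exists n, k < mim g (A :&: [set x in take n s]) (A :&: [set x in drop n s]).
Proof.
move=> us As hA.
suff /existsP[i hi] : [exists i : 'I_(size s).+1,
    k < mim g (A :&: [set x in take i s]) (A :&: [set x in drop i s])] by exists i.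
apply: contraNT hA => /existsPn h.
apply: (@width_le_seq _ _ _ (filter (mem A) s)); first exact: filter_uniq.
  by move=> x; rewrite mem_filter /=; case xA: (x \in A); rewrite //= As.
move=> n /=; rewrite cats0; have [m [-> ->]] := filter_cut (mem A) s n.
have fE t : [set x in filter (mem A) t] = A :&: [set x in t].
  by apply/setP=> x; rewrite !inE mem_filter.
rewrite !fE; case: (ltnP m (size s).+1) => hm; first by have := h (Ordinal hm); rewrite -leqNgt.
have := h ord_max; have hm' := ltnW hm.
by rewrite -leqNgt /= !(take_oversize, drop_oversize).
Qed.

Lemma width_le_sub g A B k : A \subset B -> width_le g B k -> width_le g A k.
Proof.
move=> /subsetP AB /width_leP[s [us sB hs]]; apply: contraT => hA.
have [|n] := width_gt_cut us _ hA; first by move=> x /AB; rewrite sB.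
rewrite ltnNge => /negP[]; apply: leq_trans (hs n); rewrite cats0 /=.
by apply: mim_mono => a b; rewrite !inE => /andP[_ ->] /andP[_ ->].
Qed.

Lemma cut_le_rev g k s : symmetric g -> cut_le g k [::] s [::] -> cut_le g k [::] (rev s) [::].
Proof.
move=> gs hs n; have := hs (size s - n); rewrite !cats0 /= => h.
apply: leq_trans h; rewrite take_rev drop_rev; apply: leq_trans (mim_swap _ _ gs) _.
by apply: mim_mono => a b; rewrite !inE !mem_rev => -> ->.
Qed.

Definition restr g A : rel V := fun x y => [&& x \in A, y \in A & g x y].

Definition conn_set g A := {in A &, forall x y, connect (restr g A) x y}.

Lemma connect_crossing (r : rel V) (p : pred V) a b :
  connect r a b -> p a -> ~~ p b -> exists c d, [/\ r c d, p c & ~~ p d].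
Proof.
case/connectP=> q; elim: q a => [|y q IH] a /=; first by move=> _ -> ->.
move=> /andP[ray hp] eb pa npb; case py: (p y); first exact: (IH y).
by exists a, y; rewrite ray pa py.
Qed.

(** An edge of [W] can be added to any induced matching inside [H]. Nonadjacency is stated in both
    directions because [g] is not assumed symmetric. *)
Definition separated g S (H H1 H2 : {set V}) := exists W : {set V},
  [/\ W \subset S, H1 :|: H2 \subset W, conn_set g W &
      forall a b, a \in H -> b \in W -> [&& a != b, ~~ g a b & ~~ g b a]].

Lemma separatedC g S (H H1 H2 : {set V}) : separated g S H H1 H2 -> separated g S H H2 H1.
Proof. by move=> [W hW]; exists W; rewrite setUC. Qed.

(** Since [n1 <= n2 <= n3], [H1] has a vertex before the middle cut and [H3] one after it. The
    connected set [W] then has an edge across that cut, and this edge extends the matching in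
    [H2]. *)
Lemma width_gt_step g S (H1 H2 H3 : {set V}) k s n1 n2 n3 :
  separated g S H2 H1 H3 -> s =i S -> uniq s -> n1 <= n2 <= n3 ->
  k < mim g (H1 :&: [set x in take n1 s]) (H1 :&: [set x in drop n1 s]) ->
  k < mim g (H2 :&: [set x in take n2 s]) (H2 :&: [set x in drop n2 s]) ->
  k < mim g (H3 :&: [set x in take n3 s]) (H3 :&: [set x in drop n3 s]) ->
  k.+1 < mim g [set x in take n2 s] [set x in drop n2 s].
Proof.
move=> [W [WS HW cW far]] sS us /andP[n12 n23].
move=> /mim_witness[M1 /induced_matchingP[i1 _] c1].
move=> /mim_witness[M2 /induced_matchingP[i2 j2] c2].
move=> /mim_witness[M3 /induced_matchingP[i3 _] c3].
have /card_gt0P[p1 /i1[]] : 0 < #|M1| by apply: leq_ltn_trans c1.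
rewrite !inE => /andP[a1 l1] _ _.
have /card_gt0P[p3 /i3[]] : 0 < #|M3| by apply: leq_ltn_trans c3.
rewrite !inE => _ /andP[a3 l3] _.
have dis x : x \in take n2 s -> x \in drop n2 s -> False.
  move=> x1 x2; move: us; rewrite -(cat_take_drop n2 s) cat_uniq.
  by case/and3P=> _ /hasPn/(_ x x2); rewrite x1.
have l1' : p1.1 \in take n2 s.
  by rewrite -(subnKC n12) takeD mem_cat l1.
have l3' : p3.2 \notin take n2 s.
  apply/negP => h; apply: (dis _ h).
  by move: l3; rewrite -(subnKC n23) addnC -drop_drop => /mem_drop.
have w1 : p1.1 \in W by apply: (subsetP HW); rewrite inE a1.
have w3 : p3.2 \in W by apply: (subsetP HW); rewrite inE a3 orbT.
have [c [d [/and3P[cWc dW gcd] lc ld]]] :=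
  connect_crossing (cW _ _ w1 w3) l1' l3'.
have {}lc : c \in take n2 s := lc.
have {}ld : d \notin take n2 s := ld.
have rd : d \in drop n2 s.
  have : d \in s by rewrite sS (subsetP WS).
  by rewrite -{1}(cat_take_drop n2 s) mem_cat (negPf ld).
have ncd : (c, d) \notin M2.
  apply/negP => /i2[]; rewrite inE => /andP[cH _] _ _.
  by have := far _ _ cH cWc; rewrite eqxx.
apply: (@leq_trans #|(c, d) |: M2|); last first.
  apply: card_le_mim; apply/induced_matchingP; split.
    move=> p; rewrite in_setU1 => /orP[/eqP->|/i2[]]; first by rewrite !inE.
    by rewrite !inE => /andP[_ ->] /andP[_ ->] ->.
  move=> p q; rewrite !in_setU1 => /orP[/eqP->|pM] /orP[/eqP->|qM] pq.
  - by rewrite eqxx in pq.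
  - have [] := i2 _ qM; rewrite !inE => /andP[q1 _] /andP[q2 _] _ /=.
    have /and3P[h1 h2 h3] := far _ _ q1 cWc.
    have /and3P[h4 h5 h6] := far _ _ q2 dW.
    have /and3P[h7 h8 h9] := far _ _ q2 cWc.
    by rewrite eq_sym h1 eq_sym h4.
  - have [] := i2 _ pM; rewrite !inE => /andP[q1 _] /andP[q2 _] _ /=.
    have /and3P[h1 h2 h3] := far _ _ q1 cWc.
    have /and3P[h4 h5 h6] := far _ _ q2 dW.
    have /and3P[h7 h8 h9] := far _ _ q1 dW.
    by rewrite h1 h4.
  - exact: j2.
by rewrite cardsU1 ncd add1n ltnS.
Qed.

(* Each [Hi] forces its own cut of mim more than [k]; at the median of the three
   cuts, the connected set around the two outer ones contributes one more edge. *)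
Lemma width_gt_median g S (H1 H2 H3 : {set V}) k :
  H1 \subset S -> H2 \subset S -> H3 \subset S ->
  ~~ width_le g H1 k -> ~~ width_le g H2 k -> ~~ width_le g H3 k ->
  separated g S H1 H2 H3 -> separated g S H2 H1 H3 -> separated g S H3 H1 H2 ->
  ~~ width_le g S k.+1.
Proof.
move=> s1 s2 s3 w1 w2 w3 p1 p2 p3; apply/negP => /width_leP[s [us sS hs]].
have sub (H : {set V}) : H \subset S -> {subset H <= s}.
  by move=> /subsetP HS x /HS; rewrite sS.
have [n1 h1] := width_gt_cut us (sub _ s1) w1.
have [n2 h2] := width_gt_cut us (sub _ s2) w2.
have [n3 h3] := width_gt_cut us (sub _ s3) w3.
have fin n : k.+1 < mim g [set x in take n s] [set x in drop n s] -> False.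
  by move=> hn; have := hs n; rewrite cats0 leqNgt hn.
have := (separatedC p1, separatedC p2, separatedC p3) => -[[q1 q2] q3].
(* Six of the eight cases are linear orders of the cuts; the two cyclic ones are ties, where any
   chain of two inequalities gives a median. *)
case/orP: (leq_total n1 n2) => n12; case/orP: (leq_total n2 n3) => n23;
  case/orP: (leq_total n1 n3) => n13.
all: first [ apply: (fin n2); apply: (width_gt_step p2 sS us _ h1 h2 h3); apply/andP; split; assumption
           | apply: (fin n2); apply: (width_gt_step q2 sS us _ h3 h2 h1); apply/andP; split; assumption
           | apply: (fin n1); apply: (width_gt_step p1 sS us _ h2 h1 h3); apply/andP; split; assumption
           | apply: (fin n1); apply: (width_gt_step q1 sS us _ h3 h1 h2); apply/andP; split; assumption
           | apply: (fin n3); apply: (width_gt_step p3 sS us _ h1 h3 h2); apply/andP; split; assumption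
           | apply: (fin n3); apply: (width_gt_step q3 sS us _ h2 h3 h1); apply/andP; split; assumption].
Qed.

(** The cut just before the later endpoint separates [a] from [b]. *)
Lemma width_gt0 g S a b : symmetric g -> a \in S -> b \in S -> a != b -> g a b ->
  ~~ width_le g S 0.
Proof.
move=> gs aS bS ab gab; apply/negP => /width_leP[s [us sS hs]].
wlog lab : a b aS bS ab gab / index a s < index b s.
  move=> h; have := ltngtP (index a s) (index b s); case=> hab.
  - exact: (h a b).
  - by apply: (h b a); rewrite // 1?eq_sym // gs.
  - by rewrite -(nth_index a (_ : a \in s)) ?sS // hab nth_index ?sS ?eqxx in ab.
have := hs (index b s); rewrite leqn0 => /eqP h0.
suff : #|[set (a, b)]| <= 0 by rewrite cards1.
rewrite -h0; apply: card_le_mim; apply/induced_matchingP; split.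
  move=> p /set1P->; rewrite !inE cats0 /= in_take ?sS //; split=> //.
  have : b \in s by rewrite sS.
  rewrite -{1}(cat_take_drop (index b s) s) mem_cat in_take ?sS // ltnn //.
by move=> p q /set1P-> /set1P->; rewrite eqxx.
Qed.

End Width.

Section WidthEmbedding.
Variables (V V' : finType) (g : rel V) (g' : rel V') (h : V -> V').
Hypotheses (h_inj : injective h) (h_mono : {mono h : x y / g x y >-> g' x y}).

Lemma cut_le_map k s : cut_le g' k [::] (map h s) [::] <-> cut_le g k [::] s [::].
Proof.
have hE t : [set x in map h t] = h @: [set x in t].
  by apply/setP=> y; rewrite inE; apply/mapP/imsetP => -[x xt ->]; exists x; rewrite // inE in xt *.
by split=> hs n; have := hs n; rewrite !cats0 -map_take -map_drop /= !hE (mim_imset h_inj h_mono).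
Qed.

(** Only edges inside the image matter, so an induced copy has the same width in every host
    graph. *)
Lemma width_le_imset (S : {set V}) k : width_le g' (h @: S) k = width_le g S k.
Proof.
apply/width_leP/width_leP => -[s [us sS hs]].
  have [t es] : exists t, s = map h t.
    have : {subset s <= h @: S} by move=> x; rewrite sS.
    elim: {us sS hs} s => [|y s IH] hsub; first by exists [::].
    have [t ->] := IH (fun x xs => hsub x (mem_behead (s := y :: s) xs)).
    by have /imsetP[x _ ->] := hsub y (mem_head _ _); exists (x :: t).
  exists t; subst s; split; first by rewrite (map_inj_uniq h_inj) in us.
    by move=> x; have := sS (h x); rewrite mem_map // mem_imset.
  exact/cut_le_map.
exists (map h s); split; first by rewrite map_inj_uniq.
  by move=> y; apply/mapP/imsetP => -[x xS ->]; exists x; rewrite // ?sS // -sS.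
exact/cut_le_map.
Qed.

End WidthEmbedding.

(** * Layouts and squares of arbitrary graphs *)

(** As [minn] has no neutral element, the default [n] may itself be the value. *)
Lemma bigminn_attained (I : finType) (P : pred I) (F : I -> nat) n :
  \big[minn/n]_(i | P i) F i = n \/ exists2 i, P i & \big[minn/n]_(i | P i) F i = F i.
Proof.
elim/big_rec: _ => [|i m Pi [->|[j Pj ->]]]; first by left.
  by case/orP: (leq_total (F i) n) => [/minn_idPl->|/minn_idPr->]; [right; exists i|left].
by case/orP: (leq_total (F i) (F j)) => [/minn_idPl->|/minn_idPr->]; right; [exists i|exists j].
Qed.

Lemma bigminn_le (I : finType) (P : pred I) (F : I -> nat) n i :
  P i -> \big[minn/n]_(i | P i) F i <= F i.
Proof.
move=> Pi; elim: (index_enum I) (mem_index_enum i) => [//|j r IH].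
rewrite inE big_cons => /orP[/eqP<-|/IH h]; first by rewrite Pi geq_minl.
by case: ifP => // _; rewrite geq_min h orbT.
Qed.

Section Layouts.
Variable V : finType.
Implicit Types (g e : rel V).

Lemma drop_setC (s : seq V) n : uniq s -> s =i [set: V] ->
  [set x in drop n s] = ~: [set x in take n s].
Proof.
move=> us sT; apply/setP=> x; rewrite !inE.
have : x \in s by rewrite sT inE.
move: us; rewrite -{1 2}(cat_take_drop n s) mem_cat cat_uniq => /and3P[_ /hasPn h _].
by case xt: (x \in take n s) => //= _; apply/negP => /h; rewrite /= xt.
Qed.

Lemma mw_le_seq g (sigma : layout V) k : is_layout sigma -> mw g sigma <= k ->
  width_le g setT k.
Proof.
move=> /injectiveP sinj /bigmax_leqP hk.
have [f fK Kf] : bijective sigma by apply: inj_card_bij; rewrite // card_ord.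
pose s := [seq f i | i <- enum 'I_#|V|].
have sT : s =i [set: V].
  by move=> x; rewrite inE; apply/mapP; exists (sigma x); rewrite ?mem_enum ?fK.
have us : uniq s by rewrite map_inj_uniq ?enum_uniq //; apply: can_inj Kf.
apply: (width_le_seq us sT) => n; rewrite cats0 /=.
have ts m : [set x in take m s] = prefix_set sigma m.
  apply/setP=> x; rewrite !inE in_take ?sT ?inE //.
  by rewrite -{1}(fK x) index_map ?index_enum_ord //; apply: can_inj Kf.
(* [mw] ranges over the positions from 1 to [#|V| - 1]; all other cuts have an empty side. *)
have [n0|n0] := posnP n.
  by rewrite n0 take0; apply: leq_trans (mim_no_edge _) _ => // a b; rewrite inE.
case: (ltnP n #|V|) => hn; first by have := hk (Ordinal hn) n0; rewrite -ts -drop_setC.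
have -> : drop n s = [::].
  by apply: drop_oversize; rewrite size_map size_enum_ord.
by apply: leq_trans (mim_no_edge _) _ => // a b _; rewrite inE.
Qed.

Lemma lmw_leP g k : reflect (lmw g <= k) (width_le g setT k).
Proof.
apply: (iffP idP) => [/width_leP[s [us sT hs]]|].
  have ss : size s = #|V| by rewrite -(card_uniqP us) -cardsT (eq_card sT).
  have lt x : index x s < #|V| by rewrite -ss index_mem sT inE.
  pose sigma : layout V := [ffun x => Ordinal (lt x)].
  have ls : is_layout sigma.
    apply/injectiveP => x y; rewrite !ffunE => -[hxy].
    by rewrite -(nth_index x (_ : x \in s)) ?sT ?inE // hxy nth_index ?sT ?inE.
  apply: leq_trans (bigminn_le _ _ ls) _; apply/bigmax_leqP => i _.
  have := hs i; rewrite cats0 /= drop_setC //.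
  suff -> : [set x in take i s] = prefix_set sigma i by [].
  by apply/setP=> x; rewrite !inE in_take ?sT ?inE // ffunE.
(* If the minimum is the default [#|V|], then [k] is at least [#|V|] and every order works. *)
rewrite /lmw; have [->|[sigma ls ->]] := bigminn_attained (@is_layout V) (mw g) #|V|.
  move=> nk; apply: (@width_le_seq _ _ _ _ (enum V)); rewrite ?enum_uniq //.
    by move=> x; rewrite mem_enum !inE.
  by move=> n; apply: leq_trans (mim_le_card _ _ _) nk.
exact: mw_le_seq.
Qed.

(* Midpoints of the paths realising the matching edges replace the left endpoints. *)
Lemma mim_sq_midpoints e (S T : {set V}) M :
  symmetric e -> [disjoint S & T] -> induced_matching (sq e) S T M ->
  (forall p, p \in M -> exists2 z, z \in S & e z p.2 && ((z == p.1) || e p.1 z)) ->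
  #|M| <= mim e S T.
Proof.
move=> es dST /induced_matchingP[h1 h2] hz.
(* The alternative [z == p.1] covers the pairs that are edges of [e] themselves. *)
pose mid p := odflt p.1 [pick z in S | e z p.2 && ((z == p.1) || e p.1 z)].
have midP p : p \in M ->
    [/\ mid p \in S, e (mid p) p.2 & (mid p == p.1) || e p.1 (mid p)].
  move=> pM; rewrite /mid; case: pickP => [z /and3P[]|h] //=.
  by have [z zS hz'] := hz _ pM; have := h z; rewrite zS hz'.
pose f p := (mid p, p.2).
(* Otherwise [p.1] would reach [q.2] in at most two steps through the midpoint of [p], and [M] would
   not be induced in the square. *)
have key p q : p \in M -> q \in M -> p != q -> ~~ e (mid p) q.2.
  move=> pM qM pq; have [_ _ /negP nsq] := h2 _ _ pM qM pq; apply/negP => hq.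
  have [_ _ hm] := midP _ pM; apply: nsq; rewrite /sq.
  have [p1S _ _] := h1 _ pM; have [_ q2T _] := h1 _ qM.
  have -> /= : p.1 != q.2.
    by apply: contraTneq q2T => <-; rewrite (disjointFr dST).
  case/orP: hm => [/eqP<-|hm]; first by rewrite hq.
  by apply/orP; right; apply/existsP; exists (mid p); rewrite hm hq.
have finj : {in M &, injective f}.
  move=> p q pM qM [em e2]; apply/eqP; apply: contraT => pq.
  by have [_ + _] := h2 _ _ pM qM pq; rewrite e2 eqxx.
rewrite -(card_in_imset finj); apply: card_le_mim; apply/induced_matchingP; split.
  move=> _ /imsetP[p pM ->] /=; have [mS me _] := midP _ pM.
  by have [_ p2 _] := h1 _ pM.
move=> _ _ /imsetP[p pM ->] /imsetP[q qM ->] fpq.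
have pq : p != q by apply: contra_neq fpq => ->.
have [_ n2 _] := h2 _ _ pM qM pq; split=> //=; last exact: key.
apply: contraTneq isT => em; have := key _ _ pM qM pq; rewrite em.
by have [_ -> _] := midP _ qM.
Qed.

Lemma mim_sq e (S : {set V}) : symmetric e -> mim (sq e) S (~: S) <= 2 * mim e S (~: S).
Proof.
move=> es; have sqs : symmetric (sq e).
  move=> x y; rewrite /sq eq_sym es; congr (_ && (_ || _)).
  by apply/existsP/existsP => -[z /andP[h1 h2]]; exists z; rewrite es h2 es h1.
have dS : [disjoint S & ~: S] by rewrite -setI_eq0 setICr.
apply/mim_leP => M hM; have /induced_matchingP[h1 h2] := hM.
pose N := [set p : V * V | [exists z in S, e z p.2 && ((z == p.1) || e p.1 z)]].
rewrite -(cardsID N M) mul2n -addnn; apply: leq_add.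
  apply: (@mim_sq_midpoints e) => //.
    apply/induced_matchingP; split=> [p|p q]; rewrite inE => /andP[pM _]; first exact: h1.
    by rewrite inE => /andP[qM _]; apply: h2.
  by move=> p; rewrite !inE => /andP[_ /exists_inP].
(* A pair outside [N] is no edge of [e] and its midpoints lie outside [S], so the same argument
   applies with the sides exchanged. *)
apply: leq_trans (mim_swap _ _ es).
pose sw (p : V * V) := (p.2, p.1).
have swi : injective sw by move=> [a b] [c d] [-> ->].
rewrite -(card_imset _ swi); apply: (@mim_sq_midpoints e) => //.
- by rewrite disjoint_sym.
- apply/induced_matchingP; split.
    by move=> _ /imsetP[p /setDP[/h1[pA pB pg] _] ->]; split=> //=; rewrite sqs.
  move=> _ _ /imsetP[p /setDP[pM _] ->] /imsetP[q /setDP[qM _] ->]; rewrite (inj_eq swi) => pq.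
  have [n1 n2 _] := h2 _ _ pM qM pq.
  have [_ _ n3] := h2 _ _ qM pM (contra_neq esym pq).
  by split=> //=; rewrite sqs.
move=> _ /imsetP[p /setDP[pM pN] ->] /=.
have [p1 p2 /andP[_ /orP[hp|/existsP[z /andP[z1 z2]]]]] := h1 _ pM.
  by case/negP: pN; rewrite inE; apply/exists_inP; exists p.1; rewrite ?hp ?eqxx.
exists z; last by rewrite es z1 es z2 orbT.
rewrite inE; apply: contra pN => zS; rewrite inE; apply/exists_inP; exists z => //.
by rewrite z1 z2 orbT.
Qed.

Lemma lmw_sq_le e : symmetric e -> lmw (sq e) <= 2 * lmw e.
Proof.
move=> es; apply/lmw_leP.
have /width_leP[s [us sT hs]] : width_le e setT (lmw e) by apply/lmw_leP.
apply: (width_le_seq us sT) => n; have := hs n; rewrite !cats0 /=.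
rewrite drop_setC //.
by move=> h; apply: leq_trans (mim_sq _ es) _; rewrite leq_mul2l h.
Qed.

End Layouts.

(** * Layouts starting at a given vertex *)

Section RootedLayouts.
Variables (V : finType) (e : rel V).
Hypothesis e_sym : symmetric e.
Implicit Types (A B F : {set V}).

(** The prescribed first vertex is the place where a branch, a new first vertex or a second layout
    can be attached. *)
Definition starts x A k :=
  exists t, [/\ uniq (x :: t), x :: t =i A & cut_le e k [::] (x :: t) [::]].

Lemma starts_width x A k : starts x A k -> width_le e A k.
Proof. by case=> t [u1 u2 u3]; apply: width_le_seq u3. Qed.

Lemma cut_le_head k x R : cut_le e k.+1 [::] [:: x] R.
Proof.
move=> n; apply: (@leq_trans 1) => //; apply: mim_le1 => a b a' b'.
by case: n => [|[|n]] /=; rewrite !inE // => /eqP-> /eqP-> _ _ _ _ /eqP[].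
Qed.

Lemma starts1 x k : starts x [set x] k.+1.
Proof.
exists [::]; split=> // [y|]; first by rewrite !inE.
exact: cut_le_head.
Qed.

(** Once [y] is passed, [x] has no neighbour on the right and the cuts are those of [B]; the earlier
    cuts have at most one vertex on the left. *)
Lemma starts_cons x y B k : starts y B k.+1 -> e x y -> x \notin B ->
  (forall b, b \in B -> e x b -> b = y) -> starts x (x |: B) k.+1.
Proof.
move=> [t [ut tB ht]] exy xB xb; exists (y :: t); split.
- by rewrite cons_uniq ut andbT tB.
- by move=> z; rewrite in_cons tB in_setU1.
apply: (@cut_le_cat _ _ _ _ [:: x] (y :: t)) => [|[|n]] /=; first exact: cut_le_head.
  apply: (@leq_trans 1) => //; apply: mim_le1 => a b a' b'.
  by rewrite !inE => /eqP-> /eqP-> _ _ _ _ /eqP[].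
apply: leq_trans (ht n.+1); apply: mim_mono => a b; rewrite cats0 /= !inE.
move=> /orP[/eqP->|->] // bt /xb; rewrite -tB inE (mem_drop bt) orbT => /(_ isT) eb.
by move: ut bt; rewrite eb /= => /andP[/negP yt _] /mem_drop.
Qed.

(** The branch goes right after [x], in the order [x], [F], [v], rest of [A]. While [F] and [v] are
    passed, every crossing edge not inside [F] starts at [x] or ends at [v]; as [x] and [v] are
    adjacent, no two of these are independent. *)
Lemma starts_branch x A v F k : starts x A k.+1 -> v \notin F -> e x v -> width_le e F k ->
  (forall a b, a \in A -> b \in v |: F -> (a != b) && (e a b ==> (a == x) && (b == v))) ->
  starts x (A :|: (v |: F)) k.+1.
Proof.
move=> [t [ut tA ht]] vF exv /width_leP[s [us sF hs]] hAF.
have vA : v \notin A.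
  by apply/negP => vA; have := hAF _ _ vA (setU11 _ _); rewrite eqxx.
have dAF : [disjoint A & F].
  rewrite -setI_eq0; apply/eqP/setP => z; rewrite [RHS]inE inE.
  by apply/negP => /andP[zA zF]; have := hAF _ _ zA (setU1r _ zF); rewrite eqxx.
have nAF a b : a \in A -> b \in F -> ~~ e a b.
  move=> aA bF; apply/negP => eab; have := hAF _ _ aA (setU1r _ bF).
  by rewrite eab => /and3P[_ _ /eqP bv]; rewrite bv (negPf vF) in bF.
have av a : a \in A -> e a v -> a = x.
  by move=> aA eav; have := hAF _ _ aA (setU11 _ _); rewrite eav => /and3P[_ /eqP].
have tA' y : y \in t -> y \in A by move=> yt; rewrite -tA inE yt orbT.
have uall : uniq (x :: s ++ v :: t).
  move: ut; rewrite /= !cat_uniq mem_cat /= us !inE => /andP[xt ->].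
  rewrite sF !negb_or xt (disjointFr dAF) -?tA ?mem_head //=.
  have -> : x != v by apply: contraNneq vA => <-; rewrite -tA mem_head.
  rewrite sF vF andbT (contra (tA' v)) //= andbT.
  by apply/hasPn => y /tA' yA; rewrite /= sF (disjointFr dAF).
exists (s ++ v :: t); split=> //.
  move=> y; rewrite !inE mem_cat inE -tA inE sF.
  by case: (y == x); case: (y \in F); case: (y == v); rewrite ?orbT ?orbF.
apply: (@cut_le_cat _ _ _ _ [:: x]) => /=; first exact: cut_le_head.
have xA : x \in A by rewrite -tA mem_head.
have tx y : y \in t -> y != x.
  by move=> yt; apply: contraTneq ut => <-; rewrite /= yt.
have xv_conflict c d c' d' : e c d -> e c' d' -> c != c' -> d != d' -> ~~ e c d' -> ~~ e c' d ->
    (c = x) \/ (d = v) -> (c' = x) \/ (d' = v) -> False.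
  move=> _ _ n1 n2 n3 n4 [E|E] [E'|E']; subst.
  - by rewrite eqxx in n1.
  - by rewrite exv in n3.
  - by rewrite exv in n4.
  - by rewrite eqxx in n2.
apply: cut_le_cat.
  apply: cut_le_block => // [|a b a' b']; first by rewrite cats0.
  have H c d : c \in [:: x] ++ s -> d \in s ++ (v :: t) ++ [::] -> e c d ->
      ~~ ((c \in s) && (d \in s)) -> (c = x) \/ (d = v).
    rewrite cats0 !inE mem_cat inE => /orP[/eqP->|cs]; first by left.
    rewrite cs /= => + ecd nds; rewrite (negPf nds) /= => /orP[/eqP->|/tA' dA]; first by right.
    by have := nAF d c dA; rewrite -sF cs e_sym ecd => /(_ isT).
  move=> ha ha' hb hb' eab eab' na na' n1 n2 _ _ n3 n4.
  by apply: (xv_conflict a b a' b') => //; apply: H.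
apply: (@cut_le_cat _ _ _ _ [:: v]) => /=.
  (* The single vertex [v] is a block of width 0, so the cuts next to it have mim at most 1. *)
  apply: (@cut_le_weak _ _ 1) => //; apply: cut_le_block => [n||a b a' b'].
  - by apply: mim_no_edge => a b; case: n => [|[|n]]; rewrite /= !inE.
  - by rewrite cats0.
  have H c d : c \in (x :: s) ++ [:: v] -> d \in [:: v] ++ t ++ [::] -> e c d -> (c = x) \/ (d = v).
    rewrite cats0 mem_cat !inE => /orP[/orP[/eqP->|cs]|/eqP->]; first by left.
      move=> /orP[/eqP->|/tA' dA] ecd; first by right.
      by have := nAF d c dA; rewrite -sF cs e_sym ecd => /(_ isT).
    move=> /orP[/eqP->|dt]; first by right.
    rewrite e_sym => /av edx; have := tx _ dt; rewrite edx ?eqxx //; exact: tA'.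
  move=> ha ha' hb hb' eab eab' na na' n1 n2 _ _ n3 n4.
  by apply: (xv_conflict a b a' b') => //; apply: H.
(* Past [v], only vertices of [A] have neighbours on the right; the shift to [n.+1] accounts for [x]
   at the head. *)
move=> n; apply: leq_trans (ht n.+1); apply: mim_mono => a b.
rewrite !cats0 /= !inE !mem_cat !inE => ha bt; have bt' := mem_drop bt; have bA := tA' _ bt'.
move=> eab; rewrite bt andbT; move: ha.
rewrite -!orbA => /or4P[->//|as_|/eqP av'|->]; last by rewrite orbT.
  by have := nAF b a bA; rewrite -sF as_ e_sym eab => /(_ isT).
move: eab (tx _ bt'); rewrite av' e_sym => /(av _ bA) ->; by rewrite eqxx.
Qed.

Lemma starts_branches x A k (I : finType) (v : I -> V) (F : I -> {set V}) (js : seq I) :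
  uniq js -> starts x A k.+1 ->
  (forall j, j \in js -> [/\ e x (v j), v j \notin F j & width_le e (F j) k]) ->
  (forall j a b, j \in js -> a \in A -> b \in v j |: F j ->
     (a != b) && (e a b ==> (a == x) && (b == v j))) ->
  (forall j j' a b, j \in js -> j' \in js -> j != j' ->
     a \in v j |: F j -> b \in v j' |: F j' -> (a != b) && ~~ e a b) ->
  starts x (A :|: \bigcup_(j <- js) (v j |: F j)) k.+1.
Proof.
elim: js A => [|j js IH] A /=; first by rewrite big_nil setU0.
move=> /andP[njs ujs] hA hB hAF hC; rewrite big_cons setUA.
have [h1 h2 h3] := hB j (mem_head _ _).
have sub i : i \in js -> i \in j :: js by rewrite inE orbC => ->.
apply: IH => //; first by apply: starts_branch => // a b; apply/hAF/mem_head.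
- by move=> i /sub; apply: hB.
- move=> i a b ijs /setUP[aA|aj] bi; first by apply: hAF => //; apply: sub.
  have ji : j != i by apply: contraNneq njs => ->.
  by have /andP[-> /negPf->] := hC j i a b (mem_head _ _) (sub _ ijs) ji aj bi.
- by move=> i i' a b hi hi'; apply: hC; apply: sub.
Qed.

(** The layout of [B] is reversed so that [y] comes just before [x]. Only the middle cut can be
    crossed by an edge between the halves; every other cut behaves as in its own half. *)
Lemma starts_join x y A B k : starts x A k.+1 -> starts y B k.+1 -> [disjoint A & B] ->
  (forall a b, a \in A -> b \in B -> e a b -> a = x /\ b = y) ->
  width_le e (A :|: B) k.+1.
Proof.
move=> [s [us sA hs]] [t [ut tB ht]] dAB exy.
apply: (@width_le_seq _ _ _ _ (rev (y :: t) ++ x :: s)).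
- rewrite cat_uniq rev_uniq ut us andbT andTb; apply/hasPn => z; rewrite sA => zA.
  by rewrite /= mem_rev tB (disjointFr dAB).
- by move=> z; rewrite mem_cat mem_rev tB sA orbC inE.
have yxP b a : b \in y :: t -> a \in x :: s -> e b a -> b = y /\ a = x.
  by rewrite tB sA e_sym => bB aA /(exy _ _ aA bB)[].
have mid : mim e [set z in rev (y :: t)] [set z in x :: s] <= k.+1.
  apply: (@leq_trans 1) => //; apply: mim_le1 => a b a' b'.
  rewrite ![_ \in [set _ in _]]inE !mem_rev => h1 h2 h3 h4 /(yxP _ _ h1 h3)[-> _].
  by move=> /(yxP _ _ h2 h4)[-> _]; rewrite eqxx.
have hr := cut_le_rev e_sym ht.
apply: cut_le_cat => n /=.
  case: (ltnP n (size (y :: t))) => hn; last first.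
    by rewrite take_oversize ?drop_oversize ?size_rev // cats0.
  apply: leq_trans (hr n); apply: mim_mono => a b /=.
  rewrite !cats0 !inE mem_cat => ha; rewrite ha => /orP[-> //|hb] eab.
  have [|ay _] := yxP a b _ hb eab; first by rewrite -mem_rev (mem_take ha).
  move: ha ut; rewrite rev_cons -cats1 takel_cat ?size_rev // ay => /mem_take.
  by rewrite mem_rev /= => ->.
rewrite cats0; case: n => [|n]; first by rewrite /= cats0.
apply: leq_trans (hs n.+1); apply: mim_mono => a b /=.
rewrite !inE cats0 mem_cat inE => + hb eab; rewrite hb andbT => /orP[ha|-> //].
have bs := mem_drop hb.
have [||_ bx] := yxP a b _ _ eab; [by rewrite -mem_rev | by rewrite inE bs orbT |].
by move: us; rewrite /= -bx bs.
Qed.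

End RootedLayouts.

(** * Branches of a forest *)

Lemma connect_closed_ind (T : finType) (r : rel T) (P : T -> Prop) a b :
  connect r a b -> P a -> (forall x y, P x -> r x y -> P y) -> P b.
Proof.
case/connectP => p; elim: p a => [|y p IH] a /=; first by move=> _ ->.
by move=> /andP[ray hp] eb Pa h; apply: (IH y) => //; apply: h ray.
Qed.

Section Components.
Variables (V : finType) (e : rel V).
Hypothesis e_sym : symmetric e.
Implicit Types (A B S : {set V}).

(** When [u] is not in [A], this is the singleton of [u]. *)
Definition comp A u := [set z | connect (restr e A) u z].

Lemma connect_restr_sym A : connect_sym (restr e A).
Proof. by apply: sym_connect_sym => x y; rewrite /restr e_sym andbCA. Qed.

Lemma connect_restr_mono (g : rel V) A B a b : A \subset B -> subrel e g ->
  connect (restr e A) a b -> connect (restr g B) a b.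
Proof.
move=> /subsetP AB eg; apply: connect_sub => x y /and3P[/AB xB /AB yB /eg gxy].
by apply: connect1; rewrite /restr xB yB.
Qed.

Lemma comp_refl A u : u \in comp A u. Proof. by rewrite inE. Qed.

Lemma comp_step A u a b : a \in comp A u -> a \in A -> b \in A -> e a b -> b \in comp A u.
Proof.
rewrite !inE => ua aA bA eab; apply: connect_trans ua (connect1 _).
by rewrite /restr aA bA.
Qed.

Lemma comp_min A u (P : {set V}) : u \in P ->
  (forall x y, x \in P -> x \in A -> y \in A -> e x y -> y \in P) -> comp A u \subset P.
Proof.
move=> uP h; apply/subsetP => z; rewrite inE => uz.
by apply: (@connect_closed_ind _ _ (fun z => z \in P) _ _ uz uP) => x y xP /and3P[xA yA]; apply: h.
Qed.

Lemma comp_sub A u : u \in A -> comp A u \subset A.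
Proof. by move=> uA; apply: comp_min. Qed.

Lemma comp_conn A u : u \in A -> conn_set e (comp A u).
Proof.
move=> uA; suff h z : z \in comp A u -> connect (restr e (comp A u)) u z.
  by move=> x y /h ux /h uy; apply: connect_trans uy; rewrite connect_restr_sym.
rewrite inE => uz.
have [] // := @connect_closed_ind _ _
  (fun z => z \in comp A u /\ connect (restr e (comp A u)) u z) _ _ uz.
  by split; [exact: comp_refl|].
move=> x y [xc ux] /and3P[xA yA exy]; have yc := comp_step xc xA yA exy.
by split=> //; apply: connect_trans ux (connect1 _); rewrite /restr xc yc.
Qed.

Lemma comp_incl A B u v : u \in A -> comp A u \subset B -> u \in comp B v ->
  comp A u \subset comp B v.
Proof.
move=> uA AB uv; apply/subsetP => z zA; rewrite inE.
have := uv; rewrite inE => h; apply: connect_trans h _.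
by apply: connect_restr_mono (comp_conn uA (comp_refl _ _) zA).
Qed.

Lemma comp_shrink A y v : v \in A -> y \notin comp A v -> comp (A :\ y) v = comp A v.
Proof.
move=> vA yv; have vy : v != y by apply: contraNneq yv => <-; rewrite comp_refl.
have vAy : v \in A :\ y by rewrite !inE vy.
apply/eqP; rewrite eqEsubset; apply/andP; split; apply: comp_incl; rewrite ?comp_refl //.
  by apply: subset_trans (comp_sub vAy) (subsetDl _ _).
by rewrite subsetD1 comp_sub.
Qed.

Lemma comp_branches A x : x \in A ->
  comp A x = x |: \bigcup_(v in [set v in A :\ x | e x v]) comp (A :\ x) v.
Proof.
move=> xA; apply/eqP; rewrite eqEsubset; apply/andP; split.
  apply: comp_min; rewrite ?setU11 // => a b /setU1P[->|/bigcupP[v vB av]] aA bA eab.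
    case: (eqVneq b x) => [->|bx]; first exact: setU11.
    apply/setU1r/bigcupP; exists b; rewrite ?comp_refl //.
    by rewrite !inE bx bA.
  move: vB => /setIdP[/setD1P[vx vA] exv]; rewrite inE in_set1; case: eqP => //= /eqP bx.
  apply/bigcupP; exists v; first by rewrite !inE vx vA.
  have vAx : v \in A :\ x by rewrite !inE vx.
  have aAx : a \in A :\ x by apply: (subsetP (comp_sub vAx)).
  by apply: comp_step eab; rewrite // !inE ?bx.
rewrite subUset sub1set comp_refl; apply/bigcupsP => v.
move=> /setIdP[/setD1P[vx vA] exv]; have vAx : v \in A :\ x by rewrite !inE vx.
apply: comp_incl => //; first by apply: subset_trans (comp_sub vAx) (subsetDl _ _).
by apply: comp_step exv; rewrite ?comp_refl.
Qed.

Lemma conn_set_comp S x : conn_set e S -> x \in S -> comp S x = S.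
Proof.
move=> cS xS; apply/eqP; rewrite eqEsubset comp_sub //.
by apply/subsetP => z zS; rewrite inE; apply: cS.
Qed.

End Components.

Section Forest.
Variables (V : finType) (e : rel V).
Hypotheses (e_sym : symmetric e) (e_irr : irreflexive e) (e_acyclic : acyclic e).
Implicit Types (A B S : {set V}).

(** A simple path inside [A] between distinct [a] and [b] would close through [z] to a cycle. *)
Lemma acyclic_attach A z a b : z \notin A -> e z a -> e z b ->
  connect (restr e A) a b -> a = b.
Proof.
move=> zA eza ezb /connectP[p0 hp0 eb]; move: ezb; rewrite {}eb.
case/shortenP: hp0 => p hp up _ ezl.
case: p hp up ezl => [//|c p] hp up ezl; exfalso.
have memA (q : seq V) x : path (restr e A) x q -> {subset q <= A}.
  elim: q x => [//|y q IH] x /= /andP[/and3P[_ yA _] hq] w; rewrite inE.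
  by case/orP=> [/eqP->//|/(IH _ hq)].
have aA : a \in A by case/andP: hp => /and3P[].
have zn : z \notin a :: c :: p.
  rewrite inE negb_or; apply/andP; split; first by apply: contraNneq zA => ->.
  by apply: contra zA => /(memA _ _ hp).
have := e_acyclic (c := [:: z, a, c & p]).
rewrite cons_uniq zn up => /(_ isT isT) /negP[].
have hc : path e a (c :: p) by apply: sub_path hp => x y /and3P[].
rewrite /cycle rcons_path; apply/andP; split; last by rewrite e_sym.
by rewrite /= eza.
Qed.

(** For an edge [v u], this is the part of [S] hanging from [v] through [u]. *)
Definition branch S v u := comp e (S :\ v) u.

Section Branches.
Variable S : {set V}.
Hypothesis S_conn : conn_set e S.

Let edge_neq x y : e x y -> x != y.
Proof. by apply: contraTneq => ->; rewrite e_irr. Qed.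

Lemma branch_root v u : u \in S -> e v u -> u \in S :\ v.
Proof. by move=> uS /edge_neq evu; rewrite !inE uS eq_sym evu. Qed.

Lemma branch_sub v u : u \in S -> e v u -> branch S v u \subset S :\ v.
Proof. by move=> uS evu; apply/comp_sub/branch_root. Qed.

Lemma branch_conn v u : u \in S -> e v u -> conn_set e (branch S v u).
Proof. by move=> uS evu; apply/comp_conn/branch_root. Qed.

Lemma branch_attach v u b : b \in branch S v u -> e v u -> e v b -> b = u.
Proof.
rewrite inE => ub evu evb; apply/esym/(@acyclic_attach (S :\ v) v) => //.
by rewrite !inE eqxx.
Qed.

Lemma branch_edge v u a b : u \in S -> e v u -> a \in branch S v u -> b \in S -> e a b ->
  b \in branch S v u \/ a = u /\ b = v.
Proof.
move=> uS evu au bS eab; case: (eqVneq b v) => [bv|bv].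
  by right; split=> //; apply: branch_attach au evu _; rewrite e_sym -bv.
left; apply: comp_step eab => //; last by rewrite !inE bv.
by apply: (subsetP (branch_sub uS evu)).
Qed.

(** A branch at [v] contains only one neighbour of [v], so the one through [w] avoids [x]; it
    survives the deletion of [x] and is reached through [v]. The strict inclusion makes branch sizes
    decrease along a path. *)
Lemma branch_nested x v w : v \in S -> w \in S -> e x v -> e v w -> w != x -> x \in S ->
  x \notin branch S v w /\ branch S v w \subset branch S x v :\ v.
Proof.
move=> vS wS exv evw wx xS.
have xn : x \notin branch S v w.
  apply/negP => h; have := branch_attach h evw; rewrite e_sym exv => /(_ isT) E.
  by rewrite E eqxx in wx.
split=> //; have sub := branch_sub wS evw.
rewrite subsetD1; apply/andP; split; last first.
  by apply/negP => /(subsetP sub); rewrite !inE eqxx.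
apply: comp_incl => //; first exact: branch_root.
  rewrite subsetD1 xn andbT; apply: subset_trans sub _; exact: subsetDl.
apply: comp_step evw; first exact: comp_refl; first exact: branch_root.
by rewrite !inE wx.
Qed.

Lemma branch_decomp x v : x \in S -> v \in S -> e x v ->
  branch S x v = v |: \bigcup_(w in [set w in S :\ x | e v w]) branch S v w.
Proof.
move=> xS vS exv; rewrite /branch comp_branches ?branch_root //.
congr (_ |: _); have evx : e v x by rewrite e_sym.
have -> : [set w in S :\ x :\ v | e v w] = [set w in S :\ x | e v w].
  apply/setP => w; rewrite !inE; case evw: (e v w); rewrite ?andbF //.
  by rewrite eq_sym (edge_neq evw).
apply: eq_bigr => w /setIdP[/setD1P[wx wS] evw].
have [xn _] := branch_nested vS wS exv evw wx xS.
have -> : S :\ x :\ v = S :\ v :\ x by apply/setP => z; rewrite !inE andbCA.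
by rewrite comp_shrink // branch_root.
Qed.

Lemma branch_disjoint x v v' a b : v \in S -> v' \in S -> e x v -> e x v' -> v != v' ->
  a \in branch S x v -> b \in branch S x v' -> (a != b) && ~~ e a b.
Proof.
move=> vS v'S ev ev' vv av bv.
have no c : c \in branch S x v -> c \in branch S x v' -> False.
  rewrite !inE => h1 h2; case/eqP: vv; apply: (@acyclic_attach (S :\ x) x) => //.
    by rewrite !inE eqxx.
  by apply: connect_trans h1 _; rewrite connect_restr_sym.
apply/andP; split; first by apply/eqP => E; apply: (no b); rewrite // -E.
apply/negP => eab; have bx := subsetP (branch_sub v'S ev') _ bv.
move: (bx); rewrite !inE => /andP[bx' bS].
have [h|[_ h]] := branch_edge vS ev av bS eab; first exact: (no b).
by rewrite h eqxx in bx'.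
Qed.

Lemma conn_edge_cover x y : x \in S -> y \in S -> e x y -> S = branch S y x :|: branch S x y.
Proof.
move=> xS yS exy; have eyx : e y x by rewrite e_sym.
apply/eqP; rewrite eqEsubset; apply/andP; split; last first.
  by rewrite subUset !(subset_trans (branch_sub _ _) (subsetDl _ _)).
rewrite -{1}(conn_set_comp S_conn xS); apply: comp_min; first by rewrite !inE connect0.
move=> a b /setUP[ha|ha] aS bS eab.
  have [h|[_ ->]] := branch_edge xS eyx ha bS eab; first by rewrite inE h.
  by rewrite inE orbC comp_refl.
have [h|[_ ->]] := branch_edge yS exy ha bS eab; first by rewrite inE h orbT.
by rewrite inE comp_refl.
Qed.

(** A path from a common vertex to [x] avoiding [y] would have to leave the branch through [y],
    whose only exit starts at [y]. *)
Lemma edge_branches_disjoint x y : x \in S -> y \in S -> e x y ->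
  [disjoint branch S y x & branch S x y].
Proof.
move=> xS yS exy; have eyx : e y x by rewrite e_sym.
rewrite -setI_eq0; apply/eqP/setP => z; rewrite [RHS]inE inE; apply/negP => /andP[zx zy].
have xn : x \notin branch S x y.
  by apply/negP => /(subsetP (branch_sub yS exy)); rewrite !inE eqxx.
have zxc : connect (restr e (S :\ y)) z x.
  by rewrite connect_restr_sym //; rewrite inE in zx.
have [c [d [/and3P[/setD1P[cy cS] /setD1P[dy dS] ecd] cB dB]]] :=
  connect_crossing (p := mem (branch S x y)) zxc zy xn.
have [h|[h _]] := branch_edge yS exy cB dS ecd; first by rewrite /= h in dB.
by rewrite h eqxx in cy.
Qed.

Lemma sq_sym : symmetric (sq e).
Proof.
move=> x y; rewrite /sq eq_sym e_sym; congr (_ && (_ || _)).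
by apply/existsP/existsP => -[z /andP[h1 h2]]; exists z; rewrite e_sym h2 e_sym h1.
Qed.

Lemma sub_sq : subrel e (sq e).
Proof. by move=> x y exy; rewrite /sq exy edge_neq. Qed.

Lemma conn_hub (g : rel V) (W : {set V}) h : symmetric g ->
  (forall z, z \in W -> connect (restr g W) h z) -> conn_set g W.
Proof.
move=> gs hh a b /hh ha /hh hb; apply: connect_trans hb.
by rewrite connect_restr_sym.
Qed.

(** [W] consists of the outer branches with [v1] and [v3], which are adjacent in the square through
    [x]. The vertex [x] is left out of [W], being at distance two from [u2]; what remains beyond it
    is at distance at least three from the middle branch. *)
Lemma separated_branches x v1 v2 v3 u1 u2 u3 :
  x \in S -> v1 \in S -> v2 \in S -> v3 \in S -> e x v1 -> e x v2 -> e x v3 ->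
  v1 != v2 -> v3 != v2 -> v1 != v3 ->
  u1 \in S -> u2 \in S -> u3 \in S -> e v1 u1 -> e v2 u2 -> e v3 u3 ->
  u1 != x -> u2 != x -> u3 != x ->
  separated (sq e) S (branch S v2 u2) (branch S v1 u1) (branch S v3 u3).
Proof.
move=> xS v1S v2S v3S xv1 xv2 xv3 n12 n32 n13 u1S u2S u3S e1 e2 e3 n1 n2 n3.
pose W1 v u := v |: branch S v u; pose W := W1 v1 u1 :|: W1 v3 u3.
have W1sub v u : v \in S -> e x v -> u \in S -> e v u -> u != x -> v != v2 ->
    W1 v u \subset comp e (S :\ v2) x :\ x.
  move=> vS xv uS vu ux vv2.
  have [xn sub] := branch_nested vS uS xv vu ux xS.
  have h : W1 v u \subset branch S x v.
    rewrite subUset sub1set comp_refl; apply: subset_trans sub _; exact: subsetDl.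
  have v2n : v2 \notin branch S x v.
    by apply/negP => /(branch_attach (v := x)) => /(_ xv xv2) E; rewrite E eqxx in vv2.
  apply: subset_trans h _; rewrite subsetD1; apply/andP; split; last first.
    by apply/negP => /(subsetP (branch_sub vS xv)); rewrite !inE eqxx.
  apply: comp_incl => //; first exact: branch_root.
    by rewrite subsetD1 v2n andbT; apply: subset_trans (branch_sub vS xv) (subsetDl _ _).
  have xD : x \in S :\ v2 by rewrite !inE xS edge_neq.
  by apply: comp_step xv; rewrite ?comp_refl // !inE vv2.
have WD : W \subset comp e (S :\ v2) x :\ x by rewrite subUset !W1sub.
have xD : x \in S :\ v2 by rewrite !inE xS edge_neq.
have DS := comp_sub e xD.
exists W; split.
- apply: subset_trans WD _; apply: subset_trans (subsetDl _ _) _.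
  by apply: subset_trans DS _; apply: subsetDl.
- by rewrite /W /W1; apply/subsetP => z; rewrite !inE => /orP[->|->]; rewrite ?orbT.
- apply: (@conn_hub _ _ v1); first exact: sq_sym.
  have hub v u z : W1 v u \subset W -> u \in S -> e v u -> z \in W1 v u ->
      connect (restr (sq e) W) v z.
    move=> sW uS vu /setU1P[->|zb]; first exact: connect0.
    have vW : v \in W by apply: (subsetP sW); exact: setU11.
    have uW : u \in W by apply: (subsetP sW); rewrite setU1r ?comp_refl.
    apply: (@connect_trans _ _ u).
      by apply: connect1; rewrite /restr vW uW sub_sq.
    apply: (connect_restr_mono _ sub_sq (branch_conn uS vu (comp_refl _ _ _) zb)).
    by apply: subset_trans sW; apply: subsetUr.
  move=> z /setUP[|] hz; first by apply: (hub _ u1) => //; apply: subsetUl.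
  apply: (@connect_trans _ _ v3); last by apply: (hub _ u3) => //; apply: subsetUr.
  apply: connect1; rewrite /restr !inE !eqxx ?orbT /= /sq n13 /=.
  by apply/orP; right; apply/existsP; exists x; rewrite e_sym xv1.
have no c : c \in branch S v2 u2 -> c \in comp e (S :\ v2) x -> False.
  rewrite !inE => h1 h2; case/eqP: n2; apply: (@acyclic_attach (S :\ v2) v2) => //.
  - by rewrite !inE eqxx.
  - by rewrite e_sym.
  - by apply: connect_trans h1 _; rewrite connect_restr_sym.
move=> a b ab /(subsetP WD) /setD1P[bx bD].
have := subsetP DS _ bD; rewrite 2!inE => /andP[bv2 bS].
have aS : a \in S by have := subsetP (branch_sub u2S e2) _ ab; rewrite inE => /andP[].
have nab : a != b by apply/eqP => E; apply: (no b); rewrite // -E.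
rewrite nab /= (sq_sym b a) andbb /sq nab /=; apply/negP => /orP[eab|/existsP[z /andP[az zb]]].
  have [h|[_ h]] := branch_edge u2S e2 ab bS eab; first exact: (no b).
  by rewrite h eqxx in bv2.
(* The square is taken in the whole graph, so the midpoint may a priori lie outside [S];
   connectedness of [S] and acyclicity forbid it. *)
case zS: (z \in S); last first.
  case/eqP: nab; apply: (@acyclic_attach S z); rewrite ?zS // 1?e_sym //.
  exact: S_conn.
(* If the midpoint is [v2], then [b] is a neighbour of [v2] on the side of [x], hence [x] itself,
   which is not in [W]. *)
case: (eqVneq z v2) => [zv|zv].
  case/eqP: bx; apply/esym; apply: (@acyclic_attach (S :\ v2) v2).
  - by rewrite !inE eqxx.
  - by rewrite e_sym.
  - by rewrite -zv.
  - by rewrite inE in bD.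
have [h|[_ h]] := branch_edge u2S e2 ab zS az; last by rewrite h eqxx in zv.
have [h'|[_ h']] := branch_edge u2S e2 h bS zb; first exact: (no b).
by rewrite h' eqxx in bv2.
Qed.

End Branches.
End Forest.

(** * Squares of forests *)

Section ForestWidth.
Variables (V : finType) (e : rel V).
Hypotheses (e_sym : symmetric e) (e_irr : irreflexive e) (e_acyclic : acyclic e).
Implicit Types (A B S : {set V}).

(** * Inductive step of the lower bound *)

Section Step.
Variables (S : {set V}) (k : nat).
Hypothesis S_conn : conn_set e S.
Hypothesis IHk : forall C, conn_set e C -> width_le (sq e) C k -> width_le e C k.

Definition bad x v := [&& v \in S, e x v &
  [exists u, [&& u \in S, u != x, e v u & ~~ width_le (sq e) (branch e S v u) k]]].

Lemma badI x v u : v \in S -> e x v -> u \in S -> u != x -> e v u ->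
  ~~ width_le (sq e) (branch e S v u) k -> bad x v.
Proof. by move=> h1 h2 h3 h4 h5 h6; rewrite /bad h1 h2; apply/existsP; exists u; rewrite h3 h4 h5. Qed.

Lemma badE x v : bad x v -> [/\ v \in S, e x v &
  exists u, [/\ u \in S, u != x, e v u & ~~ width_le (sq e) (branch e S v u) k]].
Proof. by case/and3P => h1 h2 /existsP[u /and4P[]]; split=> //; exists u. Qed.

Lemma three_bad x v1 v2 v3 : x \in S -> bad x v1 -> bad x v2 -> bad x v3 ->
  v1 != v2 -> v1 != v3 -> v2 != v3 -> ~~ width_le (sq e) S k.+1.
Proof.
move=> xS /badE[s1 x1 [u1 [us1 ux1 vu1 w1]]] /badE[s2 x2 [u2 [us2 ux2 vu2 w2]]].
move=> /badE[s3 x3 [u3 [us3 ux3 vu3 w3]]] n12 n13 n23.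
have sub v u : u \in S -> e v u -> branch e S v u \subset S.
  by move=> uS vu; apply: subset_trans (branch_sub e_irr uS vu) (subsetDl _ _).
have [m12 m13 m23] : [/\ v2 != v1, v3 != v1 & v3 != v2] by split; rewrite eq_sym.
apply: (@width_gt_median _ _ _ (branch e S v1 u1) (branch e S v2 u2) (branch e S v3 u3)) => //.
- exact: sub.
- exact: sub.
- exact: sub.
- exact: (@separated_branches _ _ _ _ _ _ S_conn x v2 v1 v3).
- exact: (@separated_branches _ _ _ _ _ _ S_conn x v1 v2 v3).
- exact: (@separated_branches _ _ _ _ _ _ S_conn x v1 v3 v2).
Qed.

(** Deleting [v] leaves the branches at [v] away from [x]. Their squares are narrow because [v] is
    good, so they are narrow by [IHk], and they are pairwise nonadjacent. *)
Lemma good_branch_width x v : x \in S -> v \in S -> e x v -> ~~ bad x v ->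
  width_le e (branch e S x v :\ v) k.
Proof.
move=> xS vS exv good; rewrite branch_decomp // setU1K; last first.
  apply/negP => /bigcupP[w /setIdP[/setD1P[wx wS] evw]].
  by move=> /(subsetP (branch_sub e_irr wS evw)); rewrite !inE eqxx.
rewrite -big_enum; apply: width_le_bigcup; first exact: enum_uniq.
- move=> w; rewrite mem_enum => /setIdP[/setD1P[wx wS] evw].
  apply: IHk; first exact: branch_conn.
  by apply: contraNT good; apply: badI.
move=> w w' a b; rewrite !mem_enum => /setIdP[/setD1P[_ wS] ew] /setIdP[/setD1P[_ wS'] ew'].
exact: branch_disjoint.
Qed.

(* The layout of a star of branches at [x]: [x] first, then, for each neighbour
   [v] in [X], the rest of its branch followed by [v] itself. *)
Lemma starts_star x A (X : {set V}) : x \in S -> starts e x A k.+1 ->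
  {in X, forall v, [/\ v \in S, e x v & ~~ bad x v]} ->
  (forall v a b, v \in X -> a \in A -> b \in branch e S x v ->
     (a != b) && (e a b ==> (a == x) && (b == v))) ->
  starts e x (A :|: \bigcup_(v in X) branch e S x v) k.+1.
Proof.
move=> xS hA hX hAX.
have eqB v : v |: branch e S x v :\ v = branch e S x v by rewrite setD1K ?comp_refl.
have -> : \bigcup_(v in X) branch e S x v =
          \bigcup_(v <- enum X) (v |: branch e S x v :\ v).
  by rewrite big_enum; apply: eq_bigr => v _; rewrite eqB.
apply: (@starts_branches _ _ e_sym x A k _ id (fun v => branch e S x v :\ v)) => //.
- exact: enum_uniq.
- move=> v; rewrite mem_enum => /hX[vS exv good]; split=> //; last exact: good_branch_width.
  by rewrite !inE eqxx.
- by move=> v a b; rewrite mem_enum /= eqB => vX; apply: hAX.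
move=> v v' a b; rewrite !mem_enum /= !eqB => /hX[vS exv _] /hX[v'S exv' _].
exact: branch_disjoint.
Qed.

Lemma root_star_edge x v a b : a = x -> x \in S -> v \in S -> e x v -> b \in branch e S x v ->
  (a != b) && (e a b ==> (a == x) && (b == v)).
Proof.
move=> -> xS vS exv bv; have := subsetP (branch_sub e_irr vS exv) _ bv.
rewrite !inE eqxx eq_sym => /andP[-> _] /=; apply/implyP => exb.
by apply/eqP/(branch_attach e_sym e_acyclic bv exv).
Qed.

Hypothesis S_width : width_le (sq e) S k.+1.

(** As [x'] is already bad for [x], at most one other neighbour of [x] is bad. The recursion follows
    it, prepends [x] to the layout obtained and inserts the good branches at [x]. *)
Lemma starts_bad n x' x : x' \in S -> x \in S -> e x' x -> bad x x' ->
  #|branch e S x' x| <= n -> starts e x (branch e S x' x) k.+1.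
Proof.
elim: n x' x => [|n IH] x' x x'S xS ex'x bx hn.
  by move: hn; rewrite leqNgt; case/negP; apply/card_gt0P; exists x; rewrite comp_refl.
rewrite branch_decomp //; set X := [set v in S :\ x' | e x v].
have XP v : v \in X -> [/\ v \in S, v != x' & e x v].
  by case/setIdP => /setD1P[].
have [/exists_inP[v vX bv]|/exists_inPn hX] := boolP [exists v in X, bad x v]; last first.
  apply: starts_star => //; first exact: starts1.
    by move=> v vX; have [? ? ?] := XP _ vX; split=> //; apply: hX.
  by move=> v a b /XP[vS _ exv] /set1P ax; apply: root_star_edge.
have [vS vx' exv] := XP _ vX.
have [xn sub] := branch_nested e_sym e_irr e_acyclic xS vS ex'x exv vx' x'S.
rewrite (big_setD1 v) //= setUA; apply: starts_star => //.
- apply: starts_cons => //.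
  + apply: (IH x v) => //.
      (* Badness propagates: the branch at [x] through [x'] contains the wide branch at [x'], so [x]
         is bad for [v]. *)
      have [_ _ [u [uS ux x'u wu]]] := badE bx.
      have exx' : e x x' by rewrite e_sym.
      apply: (@badI _ _ x') => //; rewrite 1?eq_sym // 1?e_sym //.
      have [_ sub'] := branch_nested e_sym e_irr e_acyclic x'S uS exx' x'u ux xS.
      apply: contra wu; apply: width_le_sub; apply: subset_trans sub' _; exact: subsetDl.
    rewrite -ltnS; apply: leq_trans hn; apply: proper_card.
    apply/properP; split; first by apply: subset_trans sub (subsetDl _ _).
    exists x; first exact: comp_refl.
    by apply/negP => /(subsetP (branch_sub e_irr vS exv)); rewrite !inE eqxx.
  + exact: exv.
  + by apply/negP => /(subsetP (branch_sub e_irr vS exv)); rewrite !inE eqxx.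
  + by move=> b bv' exb; apply: (branch_attach e_sym e_acyclic bv').
- move=> w /setD1P[wv /XP[wS wx' exw]]; split=> //; apply/negP => bw.
  have := three_bad xS bx bv bw; rewrite S_width ![x' == _]eq_sym vx' wx' eq_sym wv.
  by move=> /(_ isT isT isT).
move=> w a b /setD1P[wv /XP[wS wx' exw]] /setU1P[ax|av] bw; first exact: root_star_edge.
have vw : v != w by rewrite eq_sym.
by have /andP[-> /negPf->] := branch_disjoint e_sym e_irr e_acyclic vS wS exv exw vw av bw.
Qed.

(** A vertex without bad neighbours is the centre of a star layout. Otherwise take [v] bad for [x]
    with the smallest branch at [x] through [v]: a bad neighbour of [v] other than [x] would give a
    smaller branch, so the edge is bad in both directions and the layouts of its two sides are
    joined. *)
Lemma width_step : width_le e S k.+1.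
Proof.
have [->|[x0 x0S]] := set_0Vmem S; first exact: width_le_set0.
have [/exists_inP[x xS /forallP nb]|/exists_inPn hb] :=
  boolP [exists x in S, [forall v, ~~ bad x v]].
  rewrite -(conn_set_comp S_conn xS) comp_branches //.
  apply: (@starts_width _ _ x); apply: starts_star => //; first exact: starts1.
    by move=> v /setIdP[/setD1P[_ vS] exv]; split.
  by move=> v a b /setIdP[/setD1P[_ vS] exv] /set1P ax; apply: root_star_edge.
have exb x : x \in S -> exists v, bad x v.
  by move=> /hb; rewrite negb_forall => /existsP[v]; rewrite negbK; exists v.
have [v0 b0] := exb _ x0S.
pose P (p : V * V) := (p.1 \in S) && bad p.1 p.2.
have P0 : P (x0, v0) by rewrite /P x0S.
case: (@arg_minnP _ (x0, v0) P (fun p => #|branch e S p.1 p.2|) P0) => -[x v].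
move=> /andP[/= xS bxv] hmin; have [vS exv _] := badE bxv.
have [w bvw] := exb _ vS; have [wS evw _] := badE bvw.
have bvx : bad v x.
  case: (eqVneq w x) => [<-//|wx].
  have := hmin (v, w); rewrite /P /= vS bvw => /(_ isT).
  have [_ sub] := branch_nested e_sym e_irr e_acyclic vS wS exv evw wx xS.
  rewrite leqNgt => /negP[]; apply: proper_card; apply/properP.
  split; first by apply: subset_trans sub (subsetDl _ _).
  exists v; first exact: comp_refl.
  by apply/negP => /(subsetP (branch_sub e_irr wS evw)); rewrite !inE eqxx.
have evx : e v x by rewrite e_sym.
rewrite (conn_edge_cover e_sym e_irr e_acyclic S_conn xS vS exv).
apply: (starts_join e_sym (starts_bad vS xS evx bxv (leqnn _)) (starts_bad xS vS exv bvx (leqnn _))).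
  exact: edge_branches_disjoint.
move=> a b ax bv eab; have bS : b \in S.
  by have := subsetP (branch_sub e_irr vS exv) _ bv; rewrite inE => /andP[].
have dis := edge_branches_disjoint e_sym e_irr e_acyclic xS vS exv.
have [h|[-> ->]] := branch_edge e_sym e_irr e_acyclic xS evx ax bS eab; last by [].
by rewrite (disjointFr dis h) in bv.
Qed.

End Step.

Lemma width_le_of_sq k S : conn_set e S -> width_le (sq e) S k -> width_le e S k.
Proof.
elim: k S => [|k IH] S cS hS; last exact: width_step.
(* For [k = 0], an edge of [e] inside [S] is also one of the square and would force positive
   width. *)
have h a b : a \in S -> b \in S -> ~~ e a b.
  move=> aS bS; apply: contraL hS => eab.
  have sab := sub_sq e_irr eab; have /andP[nab _] := sab.
  exact: (width_gt0 (sq_sym e_sym) aS bS nab sab).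
have /width_leP[s [us sS _]] := hS.
apply: (width_le_seq us sS) => n; apply: mim_no_edge => a b.
by rewrite cats0 !inE => /mem_take aS /mem_drop bS; apply: h; rewrite -sS.
Qed.

End ForestWidth.

(** * Glueing copies of a rooted tree *)

(** The rank plays the role of depth, and every vertex but [r] has a unique lower neighbour, its
    parent. This certificate passes through glueing more easily than connectedness and
    acyclicity. *)
Definition rooted (V : finType) (e : rel V) (r : V) := symmetric e /\
  exists rank : V -> nat, [/\ rank r = 0,
    forall a b, e a b -> rank a != rank b,
    forall a b c, e a b -> e a c -> rank b < rank a -> rank c < rank a -> b = c &
    forall a, a != r -> exists2 b, e a b & rank b < rank a].

(** Parents lead down to [r], and a vertex of maximal rank on a cycle would have two parents. *)
Lemma rooted_tree (V : finType) (e : rel V) r : rooted e r -> is_tree e.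
Proof.
move=> [es [rank [_ rne runi rpar]]]; split.
- by split=> // x; apply/negP => /rne; rewrite eqxx.
- by apply/card_gt0P; exists r.
- suff h x : connect e x r.
    by move=> x y; apply: connect_trans (h x) _; rewrite sym_connect_sym.
  have [n] := ubnP (rank x); elim: n x => [//|n IH] x hn.
  have [->|/rpar[y exy ryx]] := eqVneq x r; first exact: connect0.
  by apply: connect_trans (connect1 exy) (IH _ _); apply: leq_trans ryx _.
move=> c uc sc; apply/negP => cc.
have [a ac amax] : exists2 a, a \in c & forall b, b \in c -> rank b <= rank a.
  case: c sc {uc cc} => // a c _; elim: c a => [|b c IH] a.
    by exists a; rewrite ?mem_head // => b; rewrite inE => /eqP->.
  have [m mc hm] := IH b; case: (leqP (rank a) (rank m)) => h.
    exists m; first by rewrite inE mc orbT.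
    by move=> z; rewrite inE => /orP[/eqP->|/hm].
  exists a; first exact: mem_head.
  by move=> z; rewrite inE => /orP[/eqP->//|/hm hz]; apply: leq_trans hz (ltnW h).
have [i p hp] := rot_to ac.
have := cc; rewrite -(rot_cycle i) hp.
have mem z : z \in p -> rank z <= rank a.
  by move=> zp; apply: amax; rewrite -(mem_rot i) hp inE zp orbT.
have up : uniq (a :: p) by rewrite -hp rot_uniq.
have szp : 2 <= size p by rewrite -ltnS -[(size p).+1]/(size (a :: p)) -hp size_rot.
case: p {hp} szp mem up => [//|b p] /=; case/lastP: p => [//|p d] _ mem up.
rewrite rcons_path last_rcons => /andP[eab /andP[_ eda]].
have ead : e a d by rewrite es.
have lt z : e a z -> z \in b :: rcons p d -> rank z < rank a.
  by move=> eaz zp; rewrite ltn_neqAle eq_sym rne // mem.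
have := runi _ _ _ eab ead (lt _ eab (mem_head _ _)) (lt _ ead _).
rewrite inE mem_rcons mem_head orbT => /(_ isT) bd.
by move: up; rewrite bd mem_rcons mem_head !andbF.
Qed.

Section Glue.
Variables (I V : finType) (e : rel V) (r : V).

(** [None] is a new root joined to the root of each copy; for [I = unit] it is a pendant vertex
    above [r]. *)
Definition glue : rel (option (I * V)) := fun a b =>
  match a, b with
  | None, None => false
  | None, Some (_, y) => y == r
  | Some (_, x), None => x == r
  | Some (i, x), Some (j, y) => (i == j) && e x y
  end.

Definition copy i (x : V) : option (I * V) := Some (i, x).

Lemma copy_inj i : injective (copy i).
Proof. by move=> x y []. Qed.

Lemma glue_copy i : {mono copy i : x y / e x y >-> glue x y}.
Proof. by move=> x y; rewrite /= eqxx. Qed.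

Lemma glue_rooted : rooted e r -> rooted glue None.
Proof.
move=> [es [rank [r0 rne runi rpar]]]; split.
  by move=> [[i x]|] [[j y]|] //=; rewrite eq_sym es.
exists (fun z => if z is Some (_, x) then (rank x).+1 else 0); split=> //.
- by move=> [[i x]|] [[j y]|] //= /andP[_ /rne].
- move=> [[i x]|] [[j y]|] [[l z]|] //=.
  + by move=> /andP[/eqP-> exy] /andP[/eqP-> exz] h1 h2; rewrite (runi x y z).
  + by move=> _ /eqP-> h; rewrite r0 in h.
  + by move=> /eqP-> _ _; rewrite r0.
move=> [[i x]|] //= _; have [->|/rpar[y exy ryx]] := eqVneq x r; first by exists None => /=.
by exists (Some (i, y)); rewrite /= ?eqxx.
Qed.

(** Distinct copies meet only through [None], which puts their roots at distance two; inside a copy,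
    a detour through [None] leads from [r] back to [r]. *)
Lemma sq_glue_copies i j x y :
  sq glue (copy i x) (copy j y) = if i == j then sq e x y else (x == r) && (y == r).
Proof.
rewrite /sq /copy; have -> : (Some (i, x) != Some (j, y)) = (i != j) || (x != y).
  by rewrite -negb_and.
have [->|ij] := eqVneq i j.
  rewrite /= eqxx /=; case xy: (x == y) => //=; congr (_ || _).
  apply/existsP/existsP => [[[[l z]|]]|[z /andP[h1 h2]]] /=.
  - by move=> /andP[/andP[_ h1] /andP[_ h2]]; exists z; rewrite h1.
  - by move=> /andP[/eqP ex /eqP ey]; rewrite ex ey eqxx in xy.
  - by exists (Some (j, z)); rewrite /= eqxx h1.
rewrite /= (negPf ij) /=; apply/existsP/idP => [[[[l z]|]]|h] //=.
  by move=> /andP[/andP[/eqP il _] /andP[/eqP lj _]]; rewrite il lj eqxx in ij.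
by exists None.
Qed.

Hypothesis e_sym : symmetric e.

Lemma glue_sym : symmetric glue.
Proof. by move=> [[i x]|] [[j y]|] //=; rewrite eq_sym e_sym. Qed.

Lemma sq_glue_copy i : {mono copy i : x y / sq e x y >-> sq glue x y}.
Proof. by move=> x y; rewrite sq_glue_copies eqxx. Qed.

Lemma sq_glue_root i x : sq glue None (copy i x) = (x == r) || e r x.
Proof.
rewrite /sq /=; congr (_ || _); apply/existsP/idP => [[[[l z]|]]|h] //=.
  by move=> /andP[/eqP-> /andP[]].
by exists (copy i r); rewrite /= !eqxx.
Qed.

Lemma width_glue_copies k : width_le e setT k -> width_le glue [set~ None] k.
Proof.
move=> hk; have -> : [set~ None] = \bigcup_(i <- enum I) (copy i @: setT).
  apply/setP => -[[i x]|]; rewrite big_enum !inE /=.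
    by apply/esym/bigcupP; exists i => //; apply: imset_f.
  by apply/esym/negbTE/negP => /bigcupP[i _ /imsetP[]].
apply: width_le_bigcup; first exact: enum_uniq.
  by move=> i _; rewrite (width_le_imset (@copy_inj i) (glue_copy i)).
move=> i j a b _ _ ij /imsetP[x _ ->] /imsetP[y _ ->]; rewrite /= (negPf ij) andbT.
by apply: contra ij => /eqP[->].
Qed.

(** Each copy ends with its root, so only the copies without their roots need width [k]. After a
    previous glueing these are disjoint unions, so two glueings cost one unit of width. *)
Lemma starts_glue k : irreflexive e -> width_le e [set~ r] k -> starts glue None setT k.+1.
Proof.
move=> eirr hk.
have -> : [set: option (I * V)] =
    [set None] :|: \bigcup_(i <- enum I) (copy i r |: copy i @: [set~ r]).
  apply/setP => -[[i x]|]; rewrite big_enum !inE //=.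
  apply/esym/bigcupP; exists i => //; rewrite !inE.
  have [->|xr] := eqVneq x r; first by rewrite eqxx.
  by rewrite orbC imset_f // !inE.
apply: (@starts_branches _ _ glue_sym _ _ _ _ (fun i => copy i r)
          (fun i => copy i @: [set~ r])).
- exact: enum_uniq.
- exact: starts1.
- move=> i _; split; first by rewrite /= eqxx.
    by apply/imsetP => -[x + [E]]; rewrite -E !inE eqxx.
  by rewrite (width_le_imset (@copy_inj i) (glue_copy i)).
- move=> i a b _ /set1P-> /setU1P[->|/imsetP[x + ->]] /=; first by rewrite !eqxx.
  by rewrite !inE => /negPf->.
have cp i a : a \in copy i r |: copy i @: [set~ r] -> exists x, a = copy i x.
  by case/setU1P => [->|/imsetP[x _ ->]]; [exists r | exists x].
move=> i j a b _ _ ij /cp[x ->] /cp[y ->]; rewrite /= (negPf ij) andbT.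
by apply: contra ij => /eqP[->].
Qed.

Lemma connect_copy (g : rel (option (I * V))) (W : {set option (I * V)}) i x :
  {homo copy i : x y / e x y >-> g x y} -> copy i @: setT \subset W ->
  connected e -> connect (restr g W) (copy i r) (copy i x).
Proof.
move=> hg /subsetP sW ce.
have inW y : copy i y \in W by apply: sW; apply: imset_f.
apply: (@connect_closed_ind _ _ (fun y => connect (restr g W) (copy i r) (copy i y)) _ _ (ce r x)).
  exact: connect0.
by move=> y z ry eyz; apply: connect_trans ry (connect1 _); rewrite /restr !inW hg.
Qed.

End Glue.

Lemma starts_imset (V V' : finType) (g : rel V) (g' : rel V') (h : V -> V') x (A : {set V}) k :
  injective h -> {mono h : x y / g x y >-> g' x y} ->
  starts g x A k -> starts g' (h x) (h @: A) k.
Proof.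
move=> hi hm [t [ut tA ht]]; exists (map h t); split.
- by rewrite -(map_inj_uniq hi) in ut.
- move=> y; rewrite -[h x :: _]/(map h (x :: t)); apply/mapP/imsetP => -[z zt ->]; exists z => //.
    by rewrite -tA.
  by rewrite tA.
exact: (iffRL (cut_le_map hi hm k (x :: t)) ht).
Qed.

Lemma starts_pendant (V : finType) (e : rel V) r k : symmetric e ->
  starts e r setT k.+1 -> starts (@glue unit V e r) None setT k.+1.
Proof.
move=> es hs.
have -> : [set: option (unit * V)] = None |: copy tt @: setT.
  by apply/setP => -[[[] x]|]; rewrite !inE //= imset_f.
apply: starts_cons.
- exact: (starts_imset (@copy_inj _ _ tt) (glue_copy _ _ tt) hs).
- by rewrite /= eqxx.
- by apply/imsetP => -[].
by move=> b /imsetP[x _ ->] /= /eqP->.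
Qed.

(** * Lower bounds from three copies *)

Section ThreeCopies.
Variables (V : finType) (e : rel V) (r : V).
Hypotheses (e_sym : symmetric e) (e_irr : irreflexive e) (e_conn : connected e).
Notation G := (@glue 'I_3 V e r).

Lemma width_gt_three_copies (g : rel (option ('I_3 * V))) (h : rel V) (A : {set V})
  (S : {set option ('I_3 * V)}) m :
  (forall i, {mono copy i : x y / h x y >-> g x y}) -> ~~ width_le h A m ->
  (forall i, copy i @: A \subset S) ->
  (forall i, exists W : {set option ('I_3 * V)}, [/\ W \subset S, forall j, j != i -> copy j @: A \subset W,
      conn_set g W & forall a b, a \in A -> b \in W ->
        [&& copy i a != b, ~~ g (copy i a) b & ~~ g b (copy i a)]]) ->
  ~~ width_le g S m.+1.
Proof.
move=> hg hA AS hW.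
have hw i : ~~ width_le g (copy i @: A) m.
  by rewrite (width_le_imset (@copy_inj _ _ i) (hg i)).
have sep i j l : j != i -> l != i ->
    separated g S (copy i @: A) (copy j @: A) (copy l @: A).
  move=> ji li; have [W [WS AW cW far]] := hW i; exists W; split=> //.
    by rewrite subUset !AW.
  by move=> _ b /imsetP[a aA ->]; apply: far.
pose i0 := @Ordinal 3 0 isT; pose i1 := @Ordinal 3 1 isT; pose i2 := @Ordinal 3 2 isT.
by apply: (@width_gt_median _ _ _ (copy i0 @: A) (copy i1 @: A) (copy i2 @: A)) => //; apply: sep.
Qed.

(** The complement of copy [i] is connected through [None], which is adjacent to no vertex of that
    copy except its root, and [A] avoids the root. *)
Lemma width_gt_glue (A : {set V}) m : r \notin A -> ~~ width_le e A m -> ~~ width_le G setT m.+1.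
Proof.
move=> rA hA; apply: (width_gt_three_copies (@glue_copy _ _ e r) hA) => [i|i]; first exact: subsetT.
pose W := [set z : option ('I_3 * V) | if z is Some (j, _) then j != i else true].
have cW j x : j != i -> copy j x \in W by rewrite inE.
exists W; split.
- exact: subsetT.
- by move=> j ji; apply/subsetP => _ /imsetP[x _ ->]; apply: cW.
- apply: (@conn_hub _ G W None); first exact: glue_sym.
  move=> [[j x]|]; rewrite inE => ji; last exact: connect0.
  apply: (@connect_trans _ _ (copy j r)).
    by apply: connect1; rewrite /restr cW //= eqxx inE.
  apply: connect_copy => //; first by move=> a b; rewrite glue_copy.
  by apply/subsetP => _ /imsetP[y _ ->]; apply: cW.
move=> a [[j y]|] aA; rewrite inE => ji /=.
  have ij : i != j by rewrite eq_sym.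
  rewrite (negPf ji) (negPf ij) /= !andbT.
  by apply: contra ji => /eqP[->].
by have /negPf-> : a != r by apply: contraNneq rA => <-.
Qed.

(** In the square, [None] may be adjacent to vertices of [A], so [W] omits it; the other copies stay
    connected because their roots are adjacent. The conclusion again concerns a set avoiding the
    root, so the lemma can be iterated. *)
Lemma width_gt_sq_glue (A : {set V}) m : r \notin A -> ~~ width_le (sq e) A m ->
  ~~ width_le (sq G) [set~ None] m.+1.
Proof.
move=> rA hA; apply: (width_gt_three_copies (@sq_glue_copy _ _ e r) hA) => [i|i].
  by apply/subsetP => _ /imsetP[x _ ->]; rewrite !inE.
pose W := [set z : option ('I_3 * V) | if z is Some (j, _) then j != i else false].
have cW j x : j != i -> copy j x \in W by rewrite inE.
have Gs : symmetric (sq G) by apply/sq_sym/glue_sym.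
exists W; split.
- by apply/subsetP => -[[j x]|]; rewrite !inE.
- by move=> j ji; apply/subsetP => _ /imsetP[x _ ->]; apply: cW.
- pose j0 : 'I_3 := if i == ord0 then ord_max else ord0.
  have j0i : j0 != i by rewrite /j0 eq_sym; case: (eqVneq i ord0) => [->|].
  apply: (@conn_hub _ _ W (copy j0 r)) => // -[[j x]|]; rewrite inE // => ji.
  apply: (@connect_trans _ _ (copy j r)).
    have [->|nj] := eqVneq j0 j; first exact: connect0.
    by apply: connect1; rewrite /restr !cW // sq_glue_copies (negPf nj) eqxx.
  apply: connect_copy => //.
    by move=> a b eab; rewrite sq_glue_copy; apply: sub_sq.
  by apply/subsetP => _ /imsetP[y _ ->]; apply: cW.
move=> a [[j y]|] aA; rewrite inE // => ji.
have ar : (a == r) = false by apply/negbTE; apply: contraNneq rA => <-.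
rewrite (Gs (copy i a)) andbb (sq_glue_copies _ _ j i y a) (negPf ji) ar andbF andbT.
by apply: contra ji => /eqP[->].
Qed.

End ThreeCopies.

(** * Extremal trees *)

(** The blocks are laid out by increasing [pos], with [cut_le_block] applied to each. An edge
    spanning position [p] but not internal to block [p] strictly increases [pos]. *)
Lemma width_le_blocks (V : finType) (g : rel V) k N (pos : V -> nat) (F : nat -> seq V) :
  (forall p, uniq (F p)) -> (forall p x, (x \in F p) = (pos x == p)) ->
  (forall p, cut_le g k [::] (F p) [::]) -> (forall x, pos x < N) ->
  (forall p a b a' b', p < N -> pos a <= p <= pos b -> pos a' <= p <= pos b' ->
     g a b -> g a' b' -> pos a < pos b -> pos a' < pos b' ->
     a != a' -> b != b' -> a != b' -> a' != b -> ~~ g a b' -> ~~ g a' b -> False) ->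
  width_le g setT k.+1.
Proof.
move=> uF memF cF posN conflict; pose fl m n := flatten [seq F p | p <- iota m n].
have memfl m n x : (x \in fl m n) = (m <= pos x < m + n).
  apply/flattenP/idP => [[_ /mapP[p + ->]]|h].
    by rewrite mem_iota memF => h /eqP->.
  exists (F (pos x)); last by rewrite memF.
  by apply/mapP; exists (pos x); rewrite // mem_iota.
have ufl m n : uniq (fl m n).
  elim: n m => [//|n IH] m; rewrite /fl /= cat_uniq uF IH andbT /=.
  apply/hasPn => x; rewrite -/(fl _ _) memfl /= memF => /andP[h _].
  by rewrite gtn_eqF.
suff H n m : m + n = N -> cut_le g k.+1 (fl 0 m) (fl m n) [::].
  apply: (@width_le_seq _ _ _ _ (fl 0 N)) => //; last exact: (H N 0).
  by move=> x; rewrite memfl inE posN.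
elim: n m => [|n IH] m mN.
  by move=> l; apply: leq_trans (mim_no_edge _) _ => // a b _; rewrite inE cats0.
have -> : fl m n.+1 = F m ++ fl m.+1 n by [].
have flS : fl 0 m ++ F m = fl 0 m.+1.
  by rewrite /fl -[m.+1]addn1 iotaD map_cat flatten_cat /= cats0.
apply: cut_le_cat; last by rewrite flS; apply: IH; rewrite addSnnS.
apply: cut_le_block => //.
  rewrite cats0 -[F m ++ _]/(fl m n.+1) /fl -flatten_cat -map_cat -{2}[m]add0n -iotaD.
  exact: ufl.
move=> a b a' b'; rewrite cats0 flS -[F m ++ _]/(fl m n.+1) !memfl !memF !add0n !ltnS mN /=.
move=> ha ha' /andP[hb _] /andP[hb' _] gab gab' na na'.
apply: (conflict m) => //; rewrite ?ha ?ha' ?hb ?hb' //.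
- by rewrite -mN addnS ltnS leq_addr.
- rewrite ltn_neqAle (leq_trans ha hb) andbT; apply: contra na => /eqP E.
  by move: ha hb; rewrite E => h1 h2; rewrite eqn_leq h1 h2.
- rewrite ltn_neqAle (leq_trans ha' hb') andbT; apply: contra na' => /eqP E.
  by move: ha' hb'; rewrite E => h1 h2; rewrite eqn_leq h1 h2.
Qed.

Section ThreeArms.
Variables (V : finType) (e : rel V) (r : V).
Hypotheses (e_sym : symmetric e) (e_irr : irreflexive e).
Notation arm := (@glue unit V e r).
Notation G := (@glue 'I_3 (option (unit * V)) arm None).
Notation W := (option ('I_3 * option (unit * V))).

(* The order of the blocks: first arm and its neighbour of the centre, the
   centre, second arm and its neighbour, third neighbour, third arm. *)
Definition arm_pos (z : W) : nat :=
  match z with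
  | None => 2
  | Some (i, None) => nth 0 [:: 1; 4; 5] i
  | Some (i, Some _) => nth 0 [:: 0; 3; 6] i
  end.

(** The square of [G] in explicit form, so that adjacencies reduce by computation: the centre and
    its three neighbours form a clique, and the centre also sees the root of each copy. *)
Definition arm_adj (z w : W) : bool :=
  match z, w with
  | None, None => false
  | None, Some (_, y) | Some (_, y), None => if y is Some (_, x) then x == r else true
  | Some (i, None), Some (j, None) => i != j
  | Some (i, None), Some (j, Some (_, x)) | Some (i, Some (_, x)), Some (j, None) =>
      (i == j) && ((x == r) || e r x)
  | Some (i, Some (_, x)), Some (j, Some (_, y)) => (i == j) && sq e x y
  end.

Lemma sq_arms : sq G =2 arm_adj.
Proof.
have as_ : symmetric arm by apply: glue_sym.
have Gs : symmetric (sq G) by apply/sq_sym/glue_sym.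
have rootE (i : 'I_3) y : sq G None (Some (i, y)) = if y is Some (_, x) then x == r else true.
  by rewrite (@sq_glue_root _ _ arm None i y); case: y => [[[] x]|].
move=> [[i y]|] [[j z]|].
- rewrite (@sq_glue_copies _ _ arm None i j y z).
  case: y z => [[[] x]|] [[[] y]|] /=; case: (eqVneq i j) => _ //=.
  + by rewrite (@sq_glue_copy _ _ e r tt x y).
  + by rewrite (sq_sym as_) (@sq_glue_root _ _ e r tt x).
  + by rewrite (@sq_glue_root _ _ e r tt y).
- by rewrite Gs rootE; case: y => [[[] x]|].
- by rewrite rootE; case: z => [[[] x]|].
- by rewrite /sq eqxx.
Qed.

Lemma width_sq_three_arms k : width_le (sq e) setT k -> width_le (sq G) setT k.+1.
Proof.
move=> /width_leP[s [us sT hs]].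
pose leaf (i : 'I_3) (x : V) : W := copy i (copy tt x).
have leaf_inj i : injective (leaf i) by move=> x y [].
have leaf_mono i : {mono leaf i : x y / sq e x y >-> sq G x y}.
  by move=> x y; rewrite sq_arms /= eqxx.
pose i0 := @Ordinal 3 0 isT; pose i1 := @Ordinal 3 1 isT; pose i2 := @Ordinal 3 2 isT.
pose F p : seq W := nth [::] [:: map (leaf i0) s; [:: Some (i0, None)]; [:: None];
  map (leaf i1) s; [:: Some (i1, None)]; [:: Some (i2, None)]; map (leaf i2) s] p.
have cut1 (z : W) : cut_le (sq G) k [::] [:: z] [::].
  move=> n; apply: leq_trans (mim_no_edge _) _ => // a b.
  by case: n => [|[|n]]; rewrite /= !inE.
have cutm i : cut_le (sq G) k [::] (map (leaf i) s) [::].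
  exact: (iffRL (cut_le_map (@leaf_inj i) (leaf_mono i) k s) hs).
have memleaf i (z : W) : (z \in map (leaf i) s) =
    if z is Some (j, Some _) then j == i else false.
  apply/mapP/idP => [[x _ ->]|]; first by rewrite /= eqxx.
  by case: z => [[j [[[] x]|]]|] // /eqP->; exists x; rewrite ?sT ?inE.
apply: (@width_le_blocks _ _ _ 7 arm_pos F).
- case=> [|[|[|[|[|[|[|p]]]]]]]; rewrite /F /= ?nth_nil //; rewrite map_inj_uniq //; exact: leaf_inj.
- case=> [|[|[|[|[|[|[|p]]]]]]] z; rewrite /F /= ?nth_nil ?memleaf ?inE;
    case: z => [[[[|[|[|i]]] Hi] [[[] x]|]]|] //.
- case=> [|[|[|[|[|[|[|p]]]]]]]; rewrite /F /= ?nth_nil.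
  + exact: cutm.
  + exact: cut1.
  + exact: cut1.
  + exact: cutm.
  + exact: cut1.
  + exact: cut1.
  + exact: cutm.
  by move=> n; apply: leq_trans (mim_no_edge _) _ => // a b; rewrite inE.
- by move=> [[[[|[|[|i]]] Hi] [[[] x]|]]|].
(* A case analysis on the places of the four endpoints: over each block, two crossing edges share an
   endpoint or have an adjacent cross pair. *)
move=> p a b a' b' _; rewrite !sq_arms => hp hp' ab ab' lt lt'.
move: ab lt hp.
case: a => [[[[|[|[|i]]] Hi] [[[] x]|]]|] //;
  case: b => [[[[|[|[|j]]] Hj] [[[] y]|]]|] //= ab _;
  case: p hp' => [|[|[|[|[|[|[|p]]]]]]] // + _; move: ab' lt';
  (case: a' => [[[[|[|[|i']]] Hi'] [[[] x']|]]|] //);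
  (case: b' => [[[[|[|[|j']]] Hj'] [[[] y']|]]|] //=).
all: by move=> ab' _ _ _ _ _ _; rewrite ?ab ?ab' ?orbT //= => n1 n2; rewrite ?ab ?ab' in n1 n2.
Qed.

End ThreeArms.

(** * The two bounds and the two families of trees *)

Lemma lmw_tree_bounds (V : finType) (e : rel V) : is_tree e ->
  lmw e <= lmw (sq e) <= 2 * lmw e.
Proof.
move=> [[es ei] _ ce ac]; rewrite lmw_sq_le // andbT; apply/lmw_leP.
apply: width_le_of_sq => //; last by apply/lmw_leP.
move=> x y _ _; apply: connect_sub (ce x y) => a b eab.
by apply: connect1; rewrite /restr !inE.
Qed.

Lemma rooted_unit : rooted (fun _ _ : unit => false) tt.
Proof. by split=> //; exists (fun=> 0); split=> // -[]. Qed.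

Lemma width_le_unit (g : rel unit) : irreflexive g -> width_le g setT 0.
Proof.
move=> gi; apply: (@width_le_seq _ _ _ _ [:: tt]) => // [[]|n]; first by rewrite !inE.
by apply: mim_no_edge => -[] [] _ _; rewrite gi.
Qed.

(** Bounding the square from above and the tree from below suffices, since the width of a tree never
    exceeds that of its square. *)
Lemma equal_width_trees k : exists (V : finType) (e : rel V) (r : V),
  [/\ rooted e r, width_le (sq e) setT k & 0 < k -> ~~ width_le e setT k.-1].
Proof.
elim: k => [|k [V [e [r [re hle hgt]]]]].
  exists unit, (fun _ _ => false), tt; split=> //; first exact: rooted_unit.
  by apply: width_le_unit => x; rewrite /sq eqxx.
have [[es ei] _ ce _] := rooted_tree re.
have ra := glue_rooted unit re; have [[as_ ai] _ ca _] := rooted_tree ra.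
have rg := glue_rooted 'I_3 ra; have [[gs gi] _ cg _] := rooted_tree rg.
exists _, (@glue 'I_3 _ (@glue unit V e r) None), None; split=> //.
  exact: width_sq_three_arms.
move=> _ /=; case: k hgt {hle} => [_|k /(_ isT) hgt].
  exact: (@width_gt0 _ _ _ None (Some (ord0, None)) gs).
(* The copy inside an arm avoids the neighbour of the centre, as the median argument demands. *)
apply: (@width_gt_glue _ _ _ as_ ca (copy tt @: setT)).
  by apply/imsetP => -[].
by rewrite (width_le_imset (@copy_inj _ _ tt) (glue_copy e r tt)).
Qed.

(** Each of the two glueings [e1] and [e2] adds one to the width of the square, while together they
    add at most one to that of the tree. The lower bound concerns the complement of the root so that
    it feeds the next step. *)
Lemma double_width_trees k : exists (V : finType) (e : rel V) (r : V),
  [/\ rooted e r, width_le e setT k & 0 < k -> ~~ width_le (sq e) [set~ r] (2 * k).-1].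
Proof.
elim: k => [|k [V [e [r [re hle hgt]]]]].
  exists unit, (fun _ _ => false), tt; split=> //; first exact: rooted_unit.
  exact: width_le_unit.
have [[es ei] _ ce _] := rooted_tree re.
pose e1 := @glue 'I_3 V e r; pose e2 := @glue 'I_3 _ e1 None; pose e3 := @glue unit _ e2 None.
have r1 : rooted e1 None := glue_rooted 'I_3 re; have [[s1 i1] _ c1 _] := rooted_tree r1.
have r2 : rooted e2 None := glue_rooted 'I_3 r1; have [[s2 i2] _ c2 _] := rooted_tree r2.
have r3 : rooted e3 None := glue_rooted unit r2.
exists _, e3, None; split=> // [|_].
  apply: (@starts_width _ _ None); apply: starts_pendant => //.
  by apply: starts_glue => //; apply: width_glue_copies.
have h1 : ~~ width_le (sq e1) [set~ None] (2 * k).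
  case: k hgt {hle} => [_|k /(_ isT) hgt]; last first.
    rewrite -[2 * k.+1]prednK //.
    by apply: (width_gt_sq_glue es ei ce _ hgt); rewrite !inE eqxx.
  (* For [k = 0], the roots of two copies are adjacent in the square. *)
  apply: (@width_gt0 _ _ _ (copy ord0 r) (copy ord_max r) (sq_sym s1)); rewrite ?inE //.
  by rewrite sq_glue_copies /= eqxx.
have h2 : ~~ width_le (sq e2) [set~ None] (2 * k).+1.
  by apply: (width_gt_sq_glue s1 i1 c1 _ h1); rewrite !inE.
rewrite mulnS /= add1n.
rewrite -(width_le_imset (@copy_inj _ _ tt) (@sq_glue_copy unit _ e2 None tt)) in h2.
apply: contra h2; apply: width_le_sub.
by apply/subsetP => _ /imsetP[x _ ->]; rewrite !inE.
Qed.

Theorem theorem1 :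
  (forall (V : finType) (e : rel V), is_tree e ->
      lmw e <= lmw (sq e) <= 2 * lmw e) /\
  (forall k : nat,
      (exists (V : finType) (e : rel V),
          [/\ is_tree e, lmw e = k & lmw (sq e) = k]) /\
      (exists (V : finType) (e : rel V),
          [/\ is_tree e, lmw e = k & lmw (sq e) = 2 * k])).
Proof.
split=> [|k]; first exact: lmw_tree_bounds.
split.
  have [V [e [r [re /lmw_leP hle hgt]]]] := equal_width_trees k.
  have te := rooted_tree re; have /andP[h1 _] := lmw_tree_bounds te.
  have h2 : k <= lmw e.
    by case: k hgt {hle} => // k /(_ isT) /lmw_leP/negP; rewrite -ltnNge.
  exists V, e; split=> //; apply/eqP; rewrite eqn_leq.
    by rewrite h2 (leq_trans h1 hle).
  by rewrite hle (leq_trans h2 h1).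
have [V [e [r [re /lmw_leP hle hgt]]]] := double_width_trees k.
have te := rooted_tree re; have /andP[_ h1] := lmw_tree_bounds te.
have h2 : 2 * k <= lmw (sq e).
  case: k hgt {hle} => [|k /(_ isT) h]; first by rewrite muln0.
  rewrite -(prednK (_ : 0 < 2 * k.+1)) // ltnNge; apply: contra h => /lmw_leP.
  by apply: width_le_sub; apply: subsetT.
have h3 : 2 * lmw e <= 2 * k by rewrite leq_mul2l.
exists V, e; split=> //; apply/eqP; rewrite eqn_leq; last by rewrite h2 (leq_trans h1).
(* The upper bound on the square, read backwards, yields the lower bound [k] for the tree. *)
by rewrite hle -(@leq_pmul2l 2) // (leq_trans h2).
Qed.
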